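(* Let $\alpha\in(0,\infty)$ and $q\in[1,\infty)$. Then, in the set of equilateral polygons with $n$ edges in $\mathbb{R}^d$, the minimizers of $\mathcal{E}_n^{\alpha,q}$ are regular polygons. In particular, a regular polygon with $n$ edges is the only minimizer, up to congruent transformations and similar transformations.
   Context: $d\ge2$. Polygons are closed, embedded in $\mathbb{R}^d$, and parametrized by arc-length. For a polygon $p_n:\mathbb{S}_L\to\mathbb{R}^d$ ($\mathbb{S}_L=\mathbb{R}/L\mathbb{Z}$) with $n$ vertices and total length $L>0$, with vertices $p_n(a_1),\dots,p_n(a_n)$, $0\le a_1<\dots<a_n<L$ (indices modulo $n$), the discrete energy is $$\mathcal{E}_n^{\alpha,q}(p_n):=\frac1\alpha L^{\alpha q-2}\sum_{\substack{i,j=1\\ i\ne j}}^n\left(\frac{1}{|p_n(a_j)-p_n(a_i)|^\alpha}-\frac{1}{D(p_n(a_j),p_n(a_i))^\alpha}\right)^q|p_n(a_{i+1})-p_n(a_i)|\,|p_n(a_{j+1})-p_n(a_j)|,$$ where $D(p_n(a_j),p_n(a_i))$ is the intrinsic distance along the polygon (the distance of $a_i$ and $a_j$ on $\mathbb{S}_L$). *)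

(* Defs.v *)
From HB Require Import structures.
From mathcomp Require Import all_boot all_order all_algebra.
From mathcomp Require Import all_classical all_reals all_analysis.

Set Implicit Arguments.
Unset Strict Implicit.
Unset Printing Implicit Defensive.

Import Order.TTheory GRing.Theory Num.Theory.

Local Open Scope classical_set_scope.
Local Open Scope ring_scope.

(* The library norm on row vectors is the sup norm, hence these definitions. *)
Definition edot (R : realType) (d : nat) (x y : 'rV[R]_d) : R :=
  \sum_k x 0 k * y 0 k.

Definition enorm (R : realType) (d : nat) (x : 'rV[R]_d) : R :=
  Num.sqrt (edot x x).

(* [next_knot a L i] is the parameter, on the real line, of the knot that
   follows [a i]; after the last knot it is [a 0 + L]. *)
Definition next_knot (R : realType) (n : nat) (a : 'I_n -> R) (L : R)
    (i : 'I_n) : R :=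
  if (i.+1 < n)%N then a (ordS i) else a (ordS i) + L.

(* A closed embedded polygon with [n] vertices, parametrized by arc-length.
   The map from R/LZ is given as an L-periodic map on the real line.
   Consecutive edges are allowed to be collinear. *)
Record polygon (R : realType) (d n : nat) := Polygon {
  plen : R;
  pmap : R -> 'rV[R]_d;
  pknot : 'I_n -> R;
  plen_gt0 : 0 < plen;
  pmap_periodic : forall t, pmap (t + plen) = pmap t;
  pmap_embedded : forall s t, 0 <= s < plen -> 0 <= t < plen ->
    pmap s = pmap t -> s = t;
  pknot_itv : forall i, 0 <= pknot i < plen;
  pknot_incr : forall i j : 'I_n, (i < j)%N -> pknot i < pknot j;
  pmap_edge : forall i, exists u : 'rV[R]_d, enorm u = 1 /\
    forall t, pknot i <= t <= next_knot pknot plen i ->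
      pmap t = pmap (pknot i) + (t - pknot i) *: u
}.

Definition vertex (R : realType) (d n : nat) (P : polygon R d n) (i : 'I_n) :
  'rV[R]_d := pmap P (pknot P i).

Definition edge_length (R : realType) (d n : nat) (P : polygon R d n)
  (i : 'I_n) : R := enorm (vertex P (ordS i) - vertex P i).

Definition equilateral (R : realType) (d n : nat) (P : polygon R d n) : Prop :=
  forall i j, edge_length P i = edge_length P j.

(* Distance on R/LZ of the classes of two representatives [s, t] in [0, L). *)
Definition circle_dist (R : realType) (L s t : R) : R :=
  Num.min `|s - t| (L - `|s - t|).

Definition arc_dist (R : realType) (d n : nat) (P : polygon R d n)
  (i j : 'I_n) : R := circle_dist (plen P) (pknot P i) (pknot P j).

Definition energy (R : realType) (d n : nat) (alpha q : R)
    (P : polygon R d n) : R :=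
  alpha^-1 * plen P `^ (alpha * q - 2) *
  \sum_(i < n) \sum_(j < n | i != j)
    (1 / enorm (vertex P j - vertex P i) `^ alpha
       - 1 / arc_dist P j i `^ alpha) `^ q
    * edge_length P i * edge_length P j.

(* The competitors are the equilateral polygons of every length. *)
Definition equilateral_minimizer (R : realType) (d n : nat) (alpha q : R)
    (P : polygon R d n) : Prop :=
  equilateral P /\
  forall Q : polygon R d n, equilateral Q ->
    energy alpha q P <= energy alpha q Q.

(* The vertices are equally spaced, in their cyclic order, on a circle of a
   2-plane: star polygons are excluded. *)
Definition regular_polygon (R : realType) (d n : nat) (P : polygon R d n) :
    Prop :=
  exists (c u w : 'rV[R]_d) (r : R),
    [/\ 0 < r, enorm u = 1, enorm w = 1, edot u w = 0 &
      forall i : 'I_n,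
        vertex P i = c + (r * cos (2 * pi * i%:R / n%:R)) *: u
                       + (r * sin (2 * pi * i%:R / n%:R)) *: w].

(* The case r = 1 is a congruence. *)
Definition similarity (R : realType) (d : nat) (f : 'rV[R]_d -> 'rV[R]_d) :
    Prop :=
  exists r : R, 0 < r /\ forall x y, enorm (f x - f y) = r * enorm (x - y).

(* Similar as unlabelled polygons: no relation between the base points or the
   orientations of the parametrizations is required. *)
Definition similar_polygons (R : realType) (d n : nat) (P Q : polygon R d n) :
    Prop :=
  exists f : 'rV[R]_d -> 'rV[R]_d,
    [/\ similarity f,
        f @` range (pmap P) = range (pmap Q) &
        f @` range (vertex P) = range (vertex Q)].

(* Main.v *)
Require Import Defs.
From mathcomp Require Import all_boot all_order all_algebra.
From mathcomp Require Import all_classical all_reals all_analysis.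
From mathcomp Require Import ring lra zify.
Import Order.TTheory GRing.Theory Num.Theory.
Local Open Scope ring_scope.

Set Implicit Arguments.
Unset Strict Implicit.
Unset Printing Implicit Defensive.

(** Number the n vertices by Z/n; with n written N.+3 this is the ring 'I_N.+3,
    so that i + k is the k-th neighbour of the vertex i. In an equilateral
    polygon all edges have one length l, the knots are evenly spaced, and the
    shorter arc between i and i + k has length l min(k, n - k). The
    energy is therefore a constant multiple of the sum over k <> 0 and i of
    F_k(y_ik), where y_ik is the chord from i to i + k measured in edges and
    F_k(y) = (1 / y^alpha - 1 / min(k, n - k)^alpha)^q [energy_equilateral].

    For fixed k the function F_k is convex and nonincreasing in y^2. Let rho_k be
    the value of y_ik for a regular polygon, with rho_k^2 = (1 - cos (2 pi k / n))
    / (1 - cos (2 pi / n)). The tangent at rho_k [pair_energy_tangent] reduces the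
    minimality of regular polygons to the inequality: the sum over i of y_ik^2 is
    at most n rho_k^2 [sum_unit_chord_le]. This is a statement about closed
    sequences of real numbers, applied to each coordinate. The discrete Fourier
    transform writes the sum of squared k-th differences as a combination with
    nonnegative weights of 1 - cos (2 pi k m / n) over the modes m
    [chord_sum_fourier], so that only single modes have to be compared
    [ordcos_mode_le], and for them it is an inequality between sines of multiples
    of an angle [sin_dilate_le].

    If the energy is minimal, there is equality for k = 2. For n > 3 the chord
    rho_2 is shorter than its arc, the tangent inequality is strict, and all
    y_i2 equal rho_2; for n = 3 second neighbours are joined by an edge. Equality
    in the Fourier estimate for k = 2 leaves only the modes 0, 1 and -1
    [chord_gap2_eq0]: the vertices lie at equal angles on an affine image of a
    circle, which is a circle since all first chords and all second chords have
    the lengths that occur in a regular polygon [ellipse_circle].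

    The lower bound is attained because a regular polygon exists: the broken line
    through equally spaced points of a circle is embedded, since each edge spans
    a supporting line [circle_edges_disjoint]. Any two regular polygons
    are related by an affine similarity whose linear part is a dilation composed
    with two reflections [regular_polygons_similar]. *)

(** * Cosines and sines of the multiples of a full turn divided by n *)

Definition ordcos (R : realType) (N : nat) (k : 'I_N.+3) : R :=
  cos (2 * pi * k%:R / N.+3%:R).

Definition ordsin (R : realType) (N : nat) (k : 'I_N.+3) : R :=
  sin (2 * pi * k%:R / N.+3%:R).

Lemma cos_sin_turn (R : realType) (x : R) (m : nat) :
  cos (x + 2 * pi * m%:R) = cos x /\ sin (x + 2 * pi * m%:R) = sin x.
Proof.
elim: m => [|m [ihc ihs]]; first by rewrite mulr0 addr0.
have -> : x + 2 * pi * m.+1%:R = (x + 2 * pi * m%:R) + pi *+ 2.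
  by rewrite -natr1 -mulr_natr; ring.
by rewrite cosD2pi sinD2pi.
Qed.

Lemma ordcos_sin_inZp (R : realType) (N m : nat) :
  ordcos R (inZp m : 'I_N.+3) = cos (2 * pi * m%:R / N.+3%:R) /\
  ordsin R (inZp m : 'I_N.+3) = sin (2 * pi * m%:R / N.+3%:R).
Proof.
rewrite /ordcos /ordsin /=.
set x : R := 2 * pi * (m %% N.+3)%:R / N.+3%:R.
have -> : 2 * pi * m%:R / N.+3%:R = x + 2 * pi * (m %/ N.+3)%:R :> R.
  have E : m%:R = (m %/ N.+3)%:R * N.+3%:R + (m %% N.+3)%:R :> R.
    by rewrite -natrM -natrD -divn_eq.
  have n0 : N.+3%:R != 0 :> R by rewrite pnatr_eq0.
  rewrite E /x; move: (N.+3%:R) n0 => n n0.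
  by field.
by have [-> ->] := cos_sin_turn x (m %/ N.+3).
Qed.

Lemma ordcos_inZp (R : realType) (N m : nat) :
  ordcos R (inZp m : 'I_N.+3) = cos (2 * pi * m%:R / N.+3%:R).
Proof. by have [] := ordcos_sin_inZp R N m. Qed.

Lemma ordsin_inZp (R : realType) (N m : nat) :
  ordsin R (inZp m : 'I_N.+3) = sin (2 * pi * m%:R / N.+3%:R).
Proof. by have [] := ordcos_sin_inZp R N m. Qed.

Lemma ordDE (N : nat) (a b : 'I_N.+3) : a + b = inZp (a + b)%N.
Proof. by apply/val_inj. Qed.

Lemma ordcosD (R : realType) (N : nat) (a b : 'I_N.+3) :
  ordcos R (a + b) = ordcos R a * ordcos R b - ordsin R a * ordsin R b.
Proof.
by rewrite ordDE ordcos_inZp natrD mulrDr mulrDl cosD.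
Qed.

Lemma ordsinD (R : realType) (N : nat) (a b : 'I_N.+3) :
  ordsin R (a + b) = ordsin R a * ordcos R b + ordcos R a * ordsin R b.
Proof.
by rewrite ordDE ordsin_inZp natrD mulrDr mulrDl sinD.
Qed.

Lemma ordcos0 (R : realType) (N : nat) : ordcos R (0 : 'I_N.+3) = 1.
Proof. by rewrite /ordcos /= mulr0 mul0r cos0. Qed.

Lemma ordsin0 (R : realType) (N : nat) : ordsin R (0 : 'I_N.+3) = 0.
Proof. by rewrite /ordsin /= mulr0 mul0r sin0. Qed.

Lemma ordcos2Dsin2 (R : realType) (N : nat) (a : 'I_N.+3) :
  ordcos R a ^+ 2 + ordsin R a ^+ 2 = 1.
Proof. exact: cos2Dsin2. Qed.

Lemma ordcosN_sinN (R : realType) (N : nat) (a : 'I_N.+3) :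
  ordcos R (- a) = ordcos R a /\ ordsin R (- a) = - ordsin R a.
Proof.
have Hc := ordcosD R a (- a); have Hs := ordsinD R a (- a).
rewrite subrr ordcos0 in Hc; rewrite subrr ordsin0 in Hs.
have H := ordcos2Dsin2 R a.
move: (ordcos R a) (ordsin R a) (ordcos R (- a)) (ordsin R (- a)) Hc Hs H.
move=> c s c' s' Hc Hs H.
have Ec : c' = (c ^+ 2 + s ^+ 2) * c' by rewrite H mul1r.
have Es : s' = (c ^+ 2 + s ^+ 2) * s' by rewrite H mul1r.
split.
  rewrite Ec; transitivity (c * (c * c' - s * s') + s * (s * c' + c * s')).
    by ring.
  by rewrite -Hc -Hs; ring.
rewrite Es; transitivity (- s * (c * c' - s * s') + c * (s * c' + c * s')).
  by ring.
by rewrite -Hc -Hs; ring.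
Qed.

Lemma ordcosN (R : realType) (N : nat) (a : 'I_N.+3) :
  ordcos R (- a) = ordcos R a.
Proof. by have [] := ordcosN_sinN R a. Qed.

Lemma ordsinN (R : realType) (N : nat) (a : 'I_N.+3) :
  ordsin R (- a) = - ordsin R a.
Proof. by have [] := ordcosN_sinN R a. Qed.

(** Reflection reduces every statement about cosines to angles in the upper
    half plane. *)
Lemma ord_half (N : nat) (k : 'I_N.+3) :
  exists j : nat, (j.*2 <= N.+3)%N /\
    (k = inZp j \/ k = - inZp j).
Proof.
case: (leqP k.*2 N.+3) => h;
  first by exists k; split=> //; left; rewrite valZpK.
exists (N.+3 - k)%N; split; first by lia.
right; apply/val_inj => /=; have := ltn_ord k => hk.
have e1 : ((N.+3 - k) %% N.+3 = N.+3 - k)%N by rewrite modn_small //; lia.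
by rewrite e1 modn_small; lia.
Qed.

Lemma half_angle_le (R : realType) (N j : nat) : (j.*2 <= N.+3)%N ->
  0 <= j%:R * ((pi : R) / N.+3%:R) <= (pi : R) / 2.
Proof.
move=> hj; have hpi := pi_gt0 R.
apply/andP; split; first by rewrite mulr_ge0 // divr_ge0 // ltW.
rewrite mulrA ler_pdivrMr ?ltr0n // [j%:R * pi]mulrC -!mulrA ler_pM2l //.
rewrite mulrC ler_pdivlMr // -natrM ler_nat; lia.
Qed.

Lemma one_sub_cos_double (R : realType) (y : R) :
  1 - cos (2 * y) = 2 * sin y ^+ 2.
Proof. by rewrite mulr_natl cos_mulr2n sin2cos2; ring. Qed.

Lemma one_sub_ordcos (R : realType) (N j : nat) :
  1 - ordcos R (inZp j : 'I_N.+3) = 2 * sin (j%:R * (pi / N.+3%:R)) ^+ 2.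
Proof.
rewrite ordcos_inZp -one_sub_cos_double; congr (1 - cos _); ring.
Qed.

Lemma sin_pi_div_gt0 (R : realType) (N : nat) : 0 < sin (pi / N.+3%:R : R).
Proof.
have hpi := pi_gt0 R.
apply: sin_gt0_pi; rewrite divr_gt0 //= ltr_pdivrMr //.
by rewrite ltr_pMr // ltr1n.
Qed.

Lemma ordcos_eq1 (R : realType) (N : nat) (k : 'I_N.+3) :
  ordcos R k = 1 -> k = 0.
Proof.
have [j [hj hk]] := ord_half k => h.
have : ordcos R (inZp j : 'I_N.+3) = 1.
  by case: hk h => ->; rewrite ?ordcosN.
move=> /eqP; rewrite eq_sym -subr_eq0 one_sub_ordcos mulf_eq0 pnatr_eq0 /=.
rewrite sqrf_eq0 => /eqP hs.
have [j0|j0] := posnP j.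
  by subst j; case: hk => ->; rewrite ?oppr_eq0; apply/val_inj => /=;
    rewrite ?mod0n ?subn0 ?modnn.
exfalso; have /andP[_ h2] := half_angle_le R hj; have hpi := pi_gt0 R.
have : 0 < sin (j%:R * (pi / N.+3%:R) : R).
  apply: sin_gt0_pi; rewrite mulr_gt0 ?divr_gt0 ?ltr0n //=.
  by apply: (le_lt_trans h2); lra.
by rewrite hs ltxx.
Qed.

Lemma ordcos_le1 (R : realType) (N : nat) (k : 'I_N.+3) : ordcos R k <= 1.
Proof. exact: cos_le1. Qed.

Lemma ordcos_lt1 (R : realType) (N : nat) (k : 'I_N.+3) :
  k != 0 -> ordcos R k < 1.
Proof.
move=> hk; rewrite lt_neqAle ordcos_le1 andbT.
by apply: contra_neq hk => /ordcos_eq1.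
Qed.

Lemma inZp1 (N : nat) : inZp 1 = 1 :> 'I_N.+3.
Proof. by apply/val_inj. Qed.

Lemma ord1_neq0 (N : nat) : (1 : 'I_N.+3) != 0.
Proof. by []. Qed.

Lemma ord2_neq0 (N : nat) : (1 + 1 : 'I_N.+3) != 0.
Proof. by []. Qed.

Lemma ordcos1_lt1 (R : realType) (N : nat) : ordcos R (1 : 'I_N.+3) < 1.
Proof. exact: ordcos_lt1 (ord1_neq0 N). Qed.

Lemma ordcos_le_ordcos1 (R : realType) (N : nat) (k : 'I_N.+3) : k != 0 ->
  ordcos R k <= ordcos R (1 : 'I_N.+3) ?= iff (k == 1) || (k == - 1).
Proof.
have [j [hj hk]] := ord_half k => k0.
have j0 : (0 < j)%N.
  rewrite lt0n; apply: contra_neq k0 => j0; subst j.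
  by case: hk => ->; apply/val_inj => /=; rewrite ?mod0n ?subn0 ?modnn.
have Ek : ordcos R k = ordcos R (inZp j : 'I_N.+3).
  by case: hk => ->; rewrite ?ordcosN.
have [j1|j1] := leqP j 1.
  have ej : j = 1%N by lia.
  subst j; rewrite Ek inZp1; split=> //; rewrite eqxx.
  by case: hk => ->; rewrite inZp1 eqxx ?orbT.
have hlt : ordcos R k < ordcos R (1 : 'I_N.+3).
  rewrite Ek -inZp1 !ordcos_inZp.
  have hpi := pi_gt0 R.
  have /andP[h1 h2] := half_angle_le R hj.
  have e1 : 2 * pi * j%:R / N.+3%:R = 2 * (j%:R * (pi / N.+3%:R)) :> R by ring.
  have e2 : 2 * pi * 1%:R / N.+3%:R = 2 * (pi / N.+3%:R) :> R by ring.
  have hp : 0 < pi / N.+3%:R :> R by rewrite divr_gt0.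
  have hlt : pi / N.+3%:R < j%:R * (pi / N.+3%:R) :> R.
    by rewrite ltr_pMl // ltr1n.
  rewrite e1 e2; move: h1 h2 hp hlt.
  set y := j%:R * (pi / N.+3%:R); set t := pi / N.+3%:R => h1 h2 hp hlt.
  by rewrite ltr_cos ?in_itv /=; [lra | apply/andP; split; lra..].
split; first exact: ltW.
rewrite lt_eqF //; symmetry; apply/negbTE/negP => /orP[] /eqP e.
  by rewrite e ltxx in hlt.
by rewrite e ordcosN ltxx in hlt.
Qed.

(** * Dilated sines *)

Lemma cos_le_cos (R : realType) (x y : R) :
  0 <= x -> x <= y -> y <= pi -> cos y <= cos x.
Proof.
move=> x0 xy yp; have := xy; rewrite le_eqVlt => /orP[/eqP->//|h].
by rewrite ltW // ltr_cos ?in_itv /= ?x0 ?yp ?(le_trans x0) ?(le_trans xy).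
Qed.

Lemma sin_le_sin (R : realType) (x y : R) :
  - (pi / 2) <= x -> x <= y -> y <= pi / 2 -> sin x <= sin y.
Proof.
move=> x0 xy yp; have := xy; rewrite le_eqVlt => /orP[/eqP->//|h].
by rewrite ltW // ltr_sin ?in_itv /= ?x0 ?yp ?(le_trans x0) ?(le_trans xy).
Qed.

(** As long as k x stays below pi / 2, the quotient of the sine of k x by the
    sine of x decreases in x. The addition formula gives the induction on k,
    because both cosines in it decrease as well. *)
Lemma sin_dilate_le_small (R : realType) (k : nat) (t x : R) :
  0 < t -> t <= x -> x <= pi / 2 -> k%:R * x <= pi / 2 ->
  sin (k%:R * x) * sin t <= sin (k%:R * t) * sin x.
Proof.
move=> t0 tx xp; have hpi := pi_gt0 R; elim: k => [|k ih] hk.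
  by rewrite !mul0r sin0 !mul0r.
have hk' : k%:R * x <= pi / 2.
  by apply: le_trans hk; rewrite ler_pM2r ?ler_nat //; lra.
have {}ih := ih hk'.
have st : 0 <= sin t by apply: sin_ge0_pi; lra.
have sx : 0 <= sin x by apply: sin_ge0_pi; lra.
have k0 : 0 <= k%:R :> R by [].
have kt : k%:R * t <= k%:R * x by rewrite ler_wpM2l.
have kt0 : 0 <= k%:R * t by rewrite mulr_ge0 // ltW.
have skx : 0 <= sin (k%:R * x) by apply: sin_ge0_pi; lra.
have cx : 0 <= cos x by apply: cos_ge0_pihalf; lra.
have cxt : cos x <= cos t by apply: cos_le_cos; lra.
have ckt : cos (k%:R * x) <= cos (k%:R * t) by apply: cos_le_cos; lra.
have skt : 0 <= sin (k%:R * t) by apply: sin_ge0_pi; lra.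
rewrite -natr1 !mulrDl !mul1r !sinD !mulrDl; apply: lerD.
  have -> : sin (k%:R * x) * cos x * sin t
          = cos x * (sin (k%:R * x) * sin t) by ring.
  apply: (le_trans (ler_wpM2l cx ih)).
  rewrite mulrC -!mulrA ler_wpM2l // mulrC ler_wpM2r //.
rewrite mulrAC -!mulrA; rewrite ler_wpM2r // ?mulr_ge0 //.
Qed.

(** When k x exceeds pi / 2, the left-hand sine is at most 1, which is the sine
    of k x at the smaller angle x = pi / 2k; there the previous lemma applies,
    and the sine of x on the right only grows from there on. *)
Lemma sin_dilate_le (R : realType) (k : nat) (t x : R) :
  0 < t -> t <= x -> x <= pi / 2 -> k%:R * t <= pi / 2 ->
  `|sin (k%:R * x)| * sin t <= sin (k%:R * t) * sin x.
Proof.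
move=> t0 tx xp kt; have hpi := pi_gt0 R.
have k0 : 0 <= k%:R :> R by [].
have st : 0 <= sin t by apply: sin_ge0_pi; lra.
case: (lerP (k%:R * x) (pi / 2)) => hkx.
  rewrite ger0_norm; first exact: sin_dilate_le_small.
  apply: sin_ge0_pi; have : 0 <= k%:R * x by rewrite mulr_ge0 //; lra.
  by lra.
have kp : 0 < k%:R :> R.
  rewrite lt_neqAle k0 andbT eq_sym; apply/negP => /eqP e.
  by rewrite e mul0r in hkx; lra.
have := @sin_dilate_le_small R k t (pi / 2 / k%:R) t0.
have -> : k%:R * (pi / 2 / k%:R) = pi / 2 :> R by field; rewrite gt_eqF.
have h1 : t <= pi / 2 / k%:R by rewrite ler_pdivlMr // mulrC.
have h2 : pi / 2 / k%:R <= x by rewrite ler_pdivrMr // mulrC; lra.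
move=> /(_ h1 (le_trans h2 xp) (lexx _)); rewrite sin_pihalf mul1r => h.
apply: (@le_trans _ _ (sin t)); first by rewrite ler_piMl // sin_max.
have kt0 : 0 <= k%:R * t by rewrite mulr_ge0 // ltW.
apply: (le_trans h); apply: ler_wpM2l; first by apply: sin_ge0_pi; lra.
by apply: sin_le_sin; lra.
Qed.

(** The chord inequality for the closed polygon that winds m times around a
    circle. Compared with its edges, its k-th chords are at most as long as
    those of the polygon that winds once. In half angles this is the square of
    the inequality between dilated sines, with t = pi / n and x = m t. *)
Lemma ordcos_mode_le (R : realType) (N : nat) (k m : 'I_N.+3) :
  (1 - ordcos R (k * m)) * (1 - ordcos R (1 : 'I_N.+3))
  <= (1 - ordcos R k) * (1 - ordcos R m).
Proof.
have [i [hi ik]] := ord_half k; have [j [hj jm]] := ord_half m.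
have -> : ordcos R k = ordcos R (inZp i : 'I_N.+3).
  by case: ik => ->; rewrite ?ordcosN.
have -> : ordcos R m = ordcos R (inZp j : 'I_N.+3).
  by case: jm => ->; rewrite ?ordcosN.
have -> : ordcos R (k * m) = ordcos R (inZp (i * j) : 'I_N.+3).
  have e : inZp i * inZp j = inZp (i * j) :> 'I_N.+3.
    by apply/val_inj => /=; rewrite modnMm.
  by case: ik => ->; case: jm => ->;
    rewrite ?mulrN ?mulNr ?opprK ?ordcosN e.
rewrite -inZp1 !one_sub_ordcos mul1r natrM.
set t : R := pi / N.+3%:R.
have [->|j0] := posnP j.
  by rewrite mulr0 mul0r sin0 !expr0n /= !(mulr0, mul0r).
have t0 : 0 < t by rewrite divr_gt0 // pi_gt0.
have /andP[_ h1] := half_angle_le R hi; have /andP[_ h2] := half_angle_le R hj.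
have h3 : t <= j%:R * t by rewrite ler_peMl ?ler1n // ltW.
have := sin_dilate_le t0 h3 h2 h1.
have -> : i%:R * j%:R * t = i%:R * (j%:R * t) by ring.
set X := sin (i%:R * (j%:R * t)); set Y := sin t => h.
have Y0 : 0 <= `|X| * Y by rewrite mulr_ge0 // ltW // sin_pi_div_gt0.
have h4 : (`|X| * Y) ^+ 2 <= (sin (i%:R * t) * sin (j%:R * t)) ^+ 2.
  by rewrite lerXn2r // nnegrE // (le_trans Y0).
by move: h4; rewrite !exprMn real_normK ?num_real //; lra.
Qed.

Lemma abs_sin_dilate_le (R : realType) (k : nat) (t : R) :
  `|sin (k%:R * t)| <= k%:R * `|sin t|.
Proof.
elim: k => [|k ih]; first by rewrite !mul0r sin0 normr0.
rewrite -natr1 !mulrDl !mul1r sinD (le_trans (ler_normD _ _)) // !normrM.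
apply: lerD.
  by apply: le_trans ih; rewrite ler_piMr // cos_max.
by rewrite ler_piMl // cos_max.
Qed.

Lemma one_sub_ordcos_le (R : realType) (N k : nat) :
  1 - ordcos R (inZp k : 'I_N.+3)
  <= k%:R ^+ 2 * (1 - ordcos R (1 : 'I_N.+3)).
Proof.
rewrite -inZp1 !one_sub_ordcos mul1r (mulrCA (k%:R ^+ 2)).
apply: ler_wpM2l => //.
rewrite -(real_normK (num_real (sin (k%:R * _)))).
rewrite -(real_normK (num_real (sin (pi / _)))) -exprMn lerXn2r ?nnegrE //.
exact: abs_sin_dilate_le.
Qed.

(** * The discrete Fourier transform of a closed sequence *)

Lemma sum_ord_shift (R : realType) (N : nat) (a : 'I_N.+3) (f : 'I_N.+3 -> R) :
  \sum_i f (i + a) = \sum_i f i.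
Proof.
symmetry; rewrite (reindex_onto (fun i => i + a) (fun i => i - a)) /=.
  by apply: eq_bigl => i; rewrite addrK eqxx.
by move=> i _; rewrite subrK.
Qed.

(** Summing a rotation over all its powers gives a vector that the rotation
    fixes, hence zero. *)
Lemma sum_ordcos_sin_mul (R : realType) (N : nat) (k : 'I_N.+3) : k != 0 ->
  \sum_m ordcos R (k * m) = 0 /\ \sum_m ordsin R (k * m) = 0.
Proof.
move=> k0; set A := \sum_m _; set B := \sum_m _.
have c1 := ordcos_lt1 R k0; have cs := ordcos2Dsin2 R k.
have hA : A = A * ordcos R k - B * ordsin R k.
  rewrite {1}/A -(sum_ord_shift 1) /A /B !mulr_suml -sumrB.
  by apply: eq_bigr => m _; rewrite mulrDr mulr1 ordcosD.
have hB : B = B * ordcos R k + A * ordsin R k.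
  rewrite {1}/B -(sum_ord_shift 1) /A /B !mulr_suml -big_split /=.
  by apply: eq_bigr => m _; rewrite mulrDr mulr1 ordsinD.
move: (ordcos R k) (ordsin R k) c1 cs hA hB => c s c1 cs hA hB.
have d0 : (1 - c) ^+ 2 + s ^+ 2 != 0.
  by rewrite gt_eqF // ltr_wpDr ?sqr_ge0 // exprn_gt0 // subr_gt0.
split; apply/eqP; rewrite -(mulrI_eq0 _ (mulfI d0)); apply/eqP.
  transitivity ((1 - c) * (A - (A * c - B * s)) + s * (- (B - (B * c + A * s)))
     + 0); first by ring.
  by rewrite -hA -hB !subrr !(mulr0, oppr0, addr0).
transitivity ((1 - c) * (B - (B * c + A * s)) + s * (A - (A * c - B * s))).
  by ring.
by rewrite -hA -hB !subrr !(mulr0, oppr0, addr0).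
Qed.

Lemma sum_ordcos_mul (R : realType) (N : nat) (k : 'I_N.+3) :
  \sum_m ordcos R (k * m) = N.+3%:R * (k == 0)%:R.
Proof.
have [->|k0] := eqVneq k 0; last first.
  by have [-> _] := sum_ordcos_sin_mul R k0; rewrite mulr0.
rewrite mulr1 (eq_bigr (fun=> 1)) => [|m _]; last by rewrite mul0r ordcos0.
by rewrite sumr_const card_ord.
Qed.

Definition fourier_cos (R : realType) (N : nat) (v : 'I_N.+3 -> R)
  (m : 'I_N.+3) : R := \sum_i v i * ordcos R (i * m).

Definition fourier_sin (R : realType) (N : nat) (v : 'I_N.+3 -> R)
  (m : 'I_N.+3) : R := \sum_i v i * ordsin R (i * m).

Definition fourier_power (R : realType) (N : nat) (v : 'I_N.+3 -> R)
  (m : 'I_N.+3) : R := fourier_cos v m ^+ 2 + fourier_sin v m ^+ 2.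

Lemma fourier_power_ge0 (R : realType) (N : nat) (v : 'I_N.+3 -> R)
    (m : 'I_N.+3) : 0 <= fourier_power v m.
Proof. by rewrite addr_ge0 ?sqr_ge0. Qed.

Lemma ordcosB (R : realType) (N : nat) (a b : 'I_N.+3) :
  ordcos R (a - b) = ordcos R a * ordcos R b + ordsin R a * ordsin R b.
Proof. by rewrite ordcosD ordcosN ordsinN mulrN opprK. Qed.

Lemma fourier_power_sum (R : realType) (N : nat) (v : 'I_N.+3 -> R)
    (m : 'I_N.+3) :
  fourier_power v m = \sum_i \sum_j v i * v j * ordcos R ((i - j) * m).
Proof.
rewrite /fourier_power !expr2 /fourier_cos /fourier_sin !mulr_suml -big_split /=.
apply: eq_bigr => i _; rewrite !mulr_sumr -big_split /=.
by apply: eq_bigr => j _; rewrite mulrBl ordcosB; ring.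
Qed.

(** The discrete Wiener-Khinchin identity: by the orthogonality relation the sum
    over m keeps only the pairs of indices at distance k. *)
Lemma sum_fourier_power (R : realType) (N : nat) (v : 'I_N.+3 -> R)
    (k : 'I_N.+3) :
  \sum_m fourier_power v m * ordcos R (k * m)
  = N.+3%:R * \sum_i v i * v (i + k).
Proof.
have pick (j0 : 'I_N.+3) (f : 'I_N.+3 -> R) (b : 'I_N.+3 -> bool) :
    (forall j, b j = (j == j0)) -> \sum_j f j * (b j)%:R = f j0.
  move=> bE; rewrite (bigD1 j0) //= bE eqxx mulr1 big1 ?addr0 // => j hj.
  by rewrite bE (negbTE hj) mulr0.
transitivity (\sum_i \sum_j (v i * v j * (N.+3%:R / 2)) *
    ((i - j + k == 0)%:R + (i - j - k == 0)%:R)).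
  under eq_bigr do rewrite fourier_power_sum mulr_suml.
  rewrite exchange_big; apply: eq_bigr => i _.
  under eq_bigr do rewrite mulr_suml.
  rewrite exchange_big; apply: eq_bigr => j _ /=.
  transitivity (v i * v j / 2 * (\sum_m ordcos R ((i - j + k) * m) +
                                 \sum_m ordcos R ((i - j - k) * m))).
    rewrite -big_split mulr_sumr; apply: eq_bigr => m _ /=.
    rewrite (mulrDl (i - j) k) (mulrDl (i - j) (- k)) mulNr ordcosD ordcosB.
    by move: (ordcos R _) (ordcos R _) (ordsin R _) (ordsin R _) => *; field.
  by rewrite !sum_ordcos_mul; field.
transitivity (\sum_i (N.+3%:R / 2) * (v i * v (i + k) + v i * v (i - k))).
  apply: eq_bigr => i _; under eq_bigr do rewrite mulrDr.
  rewrite big_split /= (@pick (i + k)) => [|j]; last first.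
    by rewrite [RHS]eq_sym -[RHS]subr_eq0 addrAC.
  rewrite (@pick (i - k)) => [|j]; last first.
    by rewrite [RHS]eq_sym -[RHS]subr_eq0 addrAC.
  by ring.
rewrite -mulr_sumr big_split /=.
have -> : \sum_i v i * v (i - k) = \sum_i v i * v (i + k).
  rewrite -(sum_ord_shift k); apply: eq_bigr => i _.
  by rewrite addrK mulrC.
by field.
Qed.

Definition chord_sum (R : realType) (N : nat) (v : 'I_N.+3 -> R)
  (k : 'I_N.+3) : R := \sum_i (v (i + k) - v i) ^+ 2.

Lemma chord_sum_fourier (R : realType) (N : nat) (v : 'I_N.+3 -> R)
    (k : 'I_N.+3) :
  N.+3%:R * chord_sum v k
  = 2 * \sum_m fourier_power v m * (1 - ordcos R (k * m)).
Proof.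
have h0 := sum_fourier_power v 0; have hk := sum_fourier_power v k.
transitivity (2 * (\sum_m fourier_power v m * ordcos R (0 * m)
                   - \sum_m fourier_power v m * ordcos R (k * m))); last first.
  rewrite -sumrB; congr (2 * _); apply: eq_bigr => m _.
  by rewrite mul0r ordcos0 mulrBr.
rewrite h0 hk -mulrBr mulrCA; congr (_ * _).
transitivity (\sum_i (v (i + k) * v (i + k)) + \sum_i v i * v i
              - 2 * \sum_i v i * v (i + k)).
  by rewrite mulr_sumr -big_split -sumrB; apply: eq_bigr => i _ /=; ring.
rewrite (sum_ord_shift k (fun i => v i * v i)).
by under [in RHS]eq_bigr do rewrite addr0; ring.
Qed.

(** This quantity vanishes for the coordinates of a regular polygon, whose sums
    of squared k-th chords are proportional to 1 - cos k. *)
Definition chord_gap (R : realType) (N : nat) (v : 'I_N.+3 -> R)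
  (k : 'I_N.+3) : R :=
  (1 - ordcos R k) * chord_sum v 1
  - (1 - ordcos R (1 : 'I_N.+3)) * chord_sum v k.

Lemma chord_gap_fourier (R : realType) (N : nat) (v : 'I_N.+3 -> R)
    (k : 'I_N.+3) :
  N.+3%:R * chord_gap v k = \sum_m 2 * fourier_power v m *
    ((1 - ordcos R k) * (1 - ordcos R m)
     - (1 - ordcos R (k * m)) * (1 - ordcos R (1 : 'I_N.+3))).
Proof.
rewrite /chord_gap mulrBr mulrCA (mulrCA N.+3%:R (1 - _)) !chord_sum_fourier.
rewrite !mulr_sumr -sumrB; apply: eq_bigr => m _.
by rewrite mul1r; ring.
Qed.

(** The inequality holds mode by mode and the power of each mode is
    nonnegative. *)
Lemma chord_gap_ge0 (R : realType) (N : nat) (v : 'I_N.+3 -> R)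
    (k : 'I_N.+3) : 0 <= chord_gap v k.
Proof.
rewrite -(pmulr_rge0 _ (ltr0Sn R N.+2)) chord_gap_fourier sumr_ge0 // => m _.
by rewrite mulr_ge0 ?mulr_ge0 ?fourier_power_ge0 // subr_ge0 ordcos_mode_le.
Qed.

Lemma ordcos_double (R : realType) (N : nat) (m : 'I_N.+3) :
  1 - ordcos R (m + m) = 2 * (1 - ordcos R m) * (1 + ordcos R m).
Proof. by have := ordcos2Dsin2 R m; rewrite ordcosD; lra. Qed.

(** For second neighbours the mode m contributes a multiple of
    (1 - cos m) (cos 1 - cos m), which vanishes for m = 0, 1, -1 only. *)
Lemma chord_gap2_eq0_power (R : realType) (N : nat) (v : 'I_N.+3 -> R)
    (m : 'I_N.+3) :
  chord_gap v (1 + 1) = 0 -> m != 0 -> m != 1 -> m != - 1 ->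
  fourier_power v m = 0.
Proof.
move=> g0 m0 m1 mN1; have := chord_gap_fourier v (1 + 1).
rewrite g0 mulr0 => /esym/eqP; rewrite psumr_eq0; last first.
  move=> i _; rewrite mulr_ge0 ?mulr_ge0 ?fourier_power_ge0 // subr_ge0.
  exact: ordcos_mode_le.
move=> /allP /(_ m (mem_index_enum m)) /=.
rewrite ordcos_double (mulrDl 1 1 m) !mul1r ordcos_double.
have [le1 eq1] := ordcos_le_ordcos1 R m0.
rewrite (negbTE m1) (negbTE mN1) /= in eq1.
have lt1 := ordcos_lt1 R m0; have l1 := ordcos1_lt1 R N.
set c := ordcos R m in le1 eq1 lt1 *; set c1 := ordcos R 1 in le1 eq1 l1 *.
have -> : 2 * (1 - c1) * (1 + c1) * (1 - c) - 2 * (1 - c) * (1 + c) * (1 - c1)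
        = 2 * (1 - c1) * (1 - c) * (c1 - c) by ring.
have h : 2 * (1 - c1) * (1 - c) * (c1 - c) != 0.
  by rewrite !mulf_neq0 // ?subr_eq0 // eq_sym ?eq1 // lt_eqF.
by rewrite mulf_eq0 (negbTE h) orbF mulf_eq0 pnatr_eq0 /= => /eqP.
Qed.

Lemma fourier_inversion (R : realType) (N : nat) (v : 'I_N.+3 -> R)
    (i : 'I_N.+3) :
  N.+3%:R * v i = \sum_m (fourier_cos v m * ordcos R (i * m)
                          + fourier_sin v m * ordsin R (i * m)).
Proof.
transitivity (\sum_j v j * \sum_m ordcos R ((j - i) * m)).
  under eq_bigr do rewrite sum_ordcos_mul.
  rewrite (bigD1 i) //= subrr eqxx mulr1 big1 ?addr0 => [|j hj].
    by rewrite mulrC.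
  by rewrite subr_eq0 (negbTE hj) !mulr0.
under eq_bigr do rewrite mulr_sumr.
rewrite exchange_big; apply: eq_bigr => m _ /=.
rewrite /fourier_cos /fourier_sin !mulr_suml -big_split /=.
by apply: eq_bigr => j _; rewrite mulrBl ordcosB; ring.
Qed.

(** Only the modes 0, 1 and -1 survive in the inversion formula. *)
Lemma chord_gap2_eq0 (R : realType) (N : nat) (v : 'I_N.+3 -> R) :
  chord_gap v (1 + 1) = 0 ->
  exists c a b : R, forall i, v i = c + a * ordcos R i + b * ordsin R i.
Proof.
move=> g0; have n0 : N.+3%:R != 0 :> R by rewrite pnatr_eq0.
have coef0 m : m != 0 -> m != 1 -> m != - 1 ->
    fourier_cos v m = 0 /\ fourier_sin v m = 0.
  move=> m0 m1 mN1; have := chord_gap2_eq0_power g0 m0 m1 mN1.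
  move=> /eqP; rewrite paddr_eq0 ?sqr_ge0 // !sqrf_eq0 => /andP[/eqP-> /eqP->].
  by [].
exists (fourier_cos v 0 / N.+3%:R),
  ((fourier_cos v 1 + fourier_cos v (- 1)) / N.+3%:R),
  ((fourier_sin v 1 - fourier_sin v (- 1)) / N.+3%:R) => i.
apply: (mulfI n0); rewrite fourier_inversion.
have ne : - 1 != 1 :> 'I_N.+3.
  by apply/eqP => /(congr1 val) /=; rewrite !modn_small //; lia.
have ne0 : - 1 != 0 :> 'I_N.+3 by rewrite oppr_eq0.
rewrite (bigD1 0) //= (bigD1 1) //= (bigD1 (- 1)) ?ne ?ne0 //=.
rewrite big1 => [|m]; last first.
  move=> /andP[/andP[m0 m1] mN1]; have [-> ->] := coef0 m m0 m1 mN1.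
  by rewrite !mul0r addr0.
rewrite mulr0 mulr1 mulrN1 ordcos0 ordsin0 ordcosN ordsinN.
by field.
Qed.

(** * Tangents to the pair energy as a function of the squared chord *)

(** Write t^q = t t^(q - 1), bound t^(q - 1) below by 1 + (q - 1) ln t, and
    then t ln t by t - 1. *)
Lemma powR_bernoulli (R : realType) (q t : R) : 1 <= q -> 0 <= t ->
  1 + q * (t - 1) <= t `^ q.
Proof.
move=> q1; rewrite le_eqVlt => /orP[/eqP<-|t0].
  by rewrite powR0; [lra | rewrite gt_eqF //; lra].
rewrite -(mulr_powRB1 (ltW t0)); last by lra.
have h1 : 1 + (q - 1) * ln t <= t `^ (q - 1).
  by rewrite /powR (gt_eqF t0) expR_ge1Dx.
have tV : 0 < t^-1 by rewrite invr_gt0.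
have h2 : - ln t <= t^-1 - 1.
  have -> : - ln t = ln (1 + (t^-1 - 1)) by rewrite addrC subrK lnV.
  by apply: le_ln1Dx; lra.
have h3 : t - 1 <= t * ln t.
  have : t * (1 - t^-1) <= t * ln t by rewrite ler_pM2l //; lra.
  by rewrite mulrBr mulr1 divff // gt_eqF.
apply: (@le_trans _ _ (t * (1 + (q - 1) * ln t))); last by rewrite ler_pM2l.
have : (q - 1) * (t - 1) <= (q - 1) * (t * ln t).
  by rewrite ler_wpM2l //; lra.
set L := t * ln t; have -> : t * (1 + (q - 1) * ln t) = t + (q - 1) * L.
  by rewrite /L; ring.
by move: L => L; lra.
Qed.

(** The function s^(- alpha / 2) of s = x^2 is strictly convex, and the left-hand
    side is its tangent at z^2. With x^(- alpha) written as an exponential, it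
    follows from exp u >= 1 + u, strict for u <> 0, and ln s <= s - 1. *)
Lemma inv_powR_tangent (R : realType) (alpha x z : R) :
  0 < alpha -> 0 < x -> 0 < z ->
  1 / z `^ alpha * (1 - alpha / 2 * (x ^+ 2 / z ^+ 2 - 1))
  <= 1 / x `^ alpha ?= iff (x == z).
Proof.
move=> a0 x0 z0; have x2 : 0 < x ^+ 2 / z ^+ 2 by rewrite divr_gt0 ?exprn_gt0.
set u := - (alpha * (ln x - ln z)).
have Ex : 1 / x `^ alpha = 1 / z `^ alpha * expR u.
  rewrite !div1r -!powRN /powR !gt_eqF // -expRD; congr expR.
  by rewrite /u; ring.
have hu : 1 - alpha / 2 * (x ^+ 2 / z ^+ 2 - 1) <= 1 + u.
  have : ln (1 + (x ^+ 2 / z ^+ 2 - 1)) <= x ^+ 2 / z ^+ 2 - 1.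
    by apply: le_ln1Dx; lra.
  rewrite addrC subrK ln_div ?posrE ?exprn_gt0 // !lnXn // => h.
  have := ler_wpM2l (ltW a0) h; rewrite /u.
  by move: (ln x) (ln z) (x ^+ 2 / z ^+ 2) => a b c; lra.
have pz : 0 < 1 / z `^ alpha by rewrite divr_gt0 ?powR_gt0.
rewrite Ex; split; first by rewrite ler_pM2l // (le_trans hu) // expR_ge1Dx.
have [xz|ne] := eqVneq x z.
  have z2 : z ^+ 2 != 0 by rewrite expf_neq0 // gt_eqF.
  by rewrite /u xz divff // !subrr !mulr0 subr0 oppr0 expR0 !mulr1 !eqxx.
rewrite lt_eqF // ltr_pM2l // (le_lt_trans hu) // expR_gt1Dx //.
rewrite oppr_eq0 mulf_eq0 (gt_eqF a0) subr_eq0 /=; apply: contra_neq ne.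
by move=> /ln_inj; apply; rewrite posrE.
Qed.

Definition pair_energy (R : realType) (alpha q d y : R) : R :=
  (1 / y `^ alpha - 1 / d `^ alpha) `^ q.

Lemma inv_powR_lt (R : realType) (alpha x y : R) : 0 < alpha -> 0 < x ->
  x < y -> 1 / y `^ alpha < 1 / x `^ alpha.
Proof.
move=> a0 x0 xy; have y0 := lt_trans x0 xy.
rewrite !div1r ltf_pV2 ?posrE ?powR_gt0 //.
by apply: gt0_ltr_powR; rewrite // nnegrE ltW.
Qed.

(** The pair energy is the convex increasing function u^q of a convex function of
    the squared chord. Bernoulli's inequality at the quotient of the two values
    of u gives the outer tangent and the previous tangent is inserted in it. When
    rho = d the value at rho is zero, and slope zero suffices. *)
Lemma pair_energy_tangent (R : realType) (alpha q d rho : R) :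
  0 < alpha -> 1 <= q -> 0 < rho -> rho <= d ->
  exists2 s : R, 0 <= s & forall y, 0 < y -> y <= d ->
    pair_energy alpha q d rho - s * (y ^+ 2 - rho ^+ 2)
      <= pair_energy alpha q d y /\
    (rho < d -> y != rho ->
     pair_energy alpha q d rho - s * (y ^+ 2 - rho ^+ 2)
      < pair_energy alpha q d y).
Proof.
move=> a0 q1 r0; rewrite le_eqVlt => /orP[/eqP->|rd].
  exists 0 => // y y0 yd; rewrite ltxx; split=> //.
  by rewrite /pair_energy subrr powR0 ?mul0r ?subr0 ?powR_ge0 // gt_eqF //; lra.
set u0 := 1 / rho `^ alpha - 1 / d `^ alpha.
have u0p : 0 < u0 by rewrite subr_gt0 inv_powR_lt.
set c := q * u0 `^ (q - 1).
have c0 : 0 < c by rewrite mulr_gt0 ?powR_gt0 //; lra.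
set s := c * (1 / rho `^ alpha) * (alpha / 2) / rho ^+ 2.
have s0 : 0 <= s.
  rewrite /s divr_ge0 ?sqr_ge0 // mulr_ge0 //; last by lra.
  by rewrite mulr_ge0 ?divr_ge0 ?powR_ge0 // ltW.
exists s => // y y0 yd.
set u := 1 / y `^ alpha - 1 / d `^ alpha.
have ge0u : 0 <= u.
  rewrite subr_ge0; move: yd; rewrite le_eqVlt => /orP[/eqP->//|yd].
  by rewrite ltW // inv_powR_lt.
have hb : pair_energy alpha q d rho + c * (u - u0) <= pair_energy alpha q d y.
  rewrite /pair_energy -/u -/u0.
  have t0 : 0 <= u / u0 by rewrite divr_ge0 // ltW.
  have -> : u `^ q = u0 `^ q * (u / u0) `^ q.
    by rewrite -powRM ?(ltW u0p) // mulrCA divff ?mulr1 // gt_eqF.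
  have h := ler_wpM2l (powR_ge0 u0 q) (powR_bernoulli q1 t0).
  apply: le_trans h; rewrite /c -(mulr_powRB1 (ltW u0p)); last by lra.
  rewrite le_eqVlt; apply/orP; left; apply/eqP; field.
  by rewrite gt_eqF.
have [t1 t2] := inv_powR_tangent a0 y0 r0.
have Es : pair_energy alpha q d rho - s * (y ^+ 2 - rho ^+ 2)
  = pair_energy alpha q d rho + c *
   (1 / rho `^ alpha * (1 - alpha / 2 * (y ^+ 2 / rho ^+ 2 - 1))
    - 1 / rho `^ alpha).
  have r2 : rho ^+ 2 != 0 by rewrite expf_neq0 // gt_eqF.
  rewrite /s; move: (1 / rho `^ alpha) (rho ^+ 2) r2 => p r r2.
  by field.
have Eu : u - u0 = 1 / y `^ alpha - 1 / rho `^ alpha by rewrite /u /u0; ring.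
rewrite Es; split.
  by apply: le_trans hb; rewrite Eu lerD2l ler_pM2l // lerD2r.
move=> _ ne; apply: lt_le_trans hb; rewrite Eu ltrD2l ltr_pM2l // ltrD2r.
by rewrite lt_neqAle t1 t2 ne.
Qed.

(** * The Euclidean norm *)

Lemma edotC (R : realType) (d : nat) (x y : 'rV[R]_d) : edot x y = edot y x.
Proof. by apply: eq_bigr => k _; rewrite mulrC. Qed.

Lemma edotDl (R : realType) (d : nat) (x y z : 'rV[R]_d) :
  edot (x + y) z = edot x z + edot y z.
Proof. by rewrite -big_split; apply: eq_bigr => k _; rewrite mxE mulrDl. Qed.

Lemma edotZl (R : realType) (d : nat) (a : R) (x z : 'rV[R]_d) :
  edot (a *: x) z = a * edot x z.
Proof. by rewrite mulr_sumr; apply: eq_bigr => k _; rewrite mxE mulrA. Qed.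

Lemma edotNl (R : realType) (d : nat) (x z : 'rV[R]_d) :
  edot (- x) z = - edot x z.
Proof. by rewrite -scaleN1r edotZl mulN1r. Qed.

Lemma edotBl (R : realType) (d : nat) (x y z : 'rV[R]_d) :
  edot (x - y) z = edot x z - edot y z.
Proof. by rewrite edotDl edotNl. Qed.

Lemma edotDr (R : realType) (d : nat) (x y z : 'rV[R]_d) :
  edot z (x + y) = edot z x + edot z y.
Proof. by rewrite edotC edotDl !(edotC z). Qed.

Lemma edotZr (R : realType) (d : nat) (a : R) (x z : 'rV[R]_d) :
  edot z (a *: x) = a * edot z x.
Proof. by rewrite edotC edotZl (edotC z). Qed.

Lemma edotNr (R : realType) (d : nat) (x z : 'rV[R]_d) :
  edot z (- x) = - edot z x.
Proof. by rewrite edotC edotNl (edotC z). Qed.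

Lemma edotBr (R : realType) (d : nat) (x y z : 'rV[R]_d) :
  edot z (x - y) = edot z x - edot z y.
Proof. by rewrite edotDr edotNr. Qed.

Definition edotE := (edotDl, edotBl, edotNl, edotZl, edotDr, edotBr, edotNr,
  edotZr).

Lemma edot_ge0 (R : realType) (d : nat) (x : 'rV[R]_d) : 0 <= edot x x.
Proof. by apply: sumr_ge0 => k _; rewrite -expr2 sqr_ge0. Qed.

Lemma edot_eq0 (R : realType) (d : nat) (x : 'rV[R]_d) :
  edot x x = 0 -> x = 0.
Proof.
move=> /eqP; rewrite psumr_eq0 => [/allP h|k _]; last by rewrite -expr2 sqr_ge0.
apply/rowP => k; rewrite mxE; apply/eqP.
by have := h k (mem_index_enum k); rewrite /= -expr2 sqrf_eq0.
Qed.

Lemma enorm_ge0 (R : realType) (d : nat) (x : 'rV[R]_d) : 0 <= enorm x.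
Proof. exact: sqrtr_ge0. Qed.

Lemma enorm_sqr (R : realType) (d : nat) (x : 'rV[R]_d) :
  enorm x ^+ 2 = edot x x.
Proof. by rewrite sqr_sqrtr // edot_ge0. Qed.

Lemma enorm_eq_edot (R : realType) (d : nat) (x : 'rV[R]_d) (a : R) :
  0 <= a -> edot x x = a ^+ 2 -> enorm x = a.
Proof. by move=> a0 h; rewrite /enorm h sqrtr_sqr ger0_norm. Qed.

Lemma enorm_eq0 (R : realType) (d : nat) (x : 'rV[R]_d) :
  enorm x = 0 -> x = 0.
Proof. by move=> h; apply: edot_eq0; rewrite -enorm_sqr h expr0n. Qed.

Lemma enormZ (R : realType) (d : nat) (a : R) (x : 'rV[R]_d) :
  0 <= a -> enorm (a *: x) = a * enorm x.
Proof.
move=> a0; apply: enorm_eq_edot; first by rewrite mulr_ge0 // enorm_ge0.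
by rewrite !edotE exprMn enorm_sqr; ring.
Qed.

Lemma enormN (R : realType) (d : nat) (x : 'rV[R]_d) : enorm (- x) = enorm x.
Proof. by rewrite /enorm !edotE opprK. Qed.

Lemma edot_le (R : realType) (d : nat) (x y : 'rV[R]_d) :
  edot x y <= enorm x * enorm y.
Proof.
have := edot_ge0 (enorm y *: x - enorm x *: y).
rewrite !edotE (edotC y x) -!enorm_sqr.
have := enorm_ge0 x; have := enorm_ge0 y.
rewrite le_eqVlt => /orP[/eqP y0 _ _|y0].
  by rewrite (enorm_eq0 (esym y0)) -(scale0r x) edotZr
    (enormZ _ (lexx 0)) !mul0r mulr0.
rewrite le_eqVlt => /orP[/eqP x0 _|x0].
  by rewrite (enorm_eq0 (esym x0)) -(scale0r y) edotZl
    (enormZ _ (lexx 0)) !mul0r.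
have xy : 0 < enorm x * enorm y by rewrite mulr_gt0.
move: (enorm x) (enorm y) (edot x y) xy => a b e xy h.
have : 0 <= (2 * (a * b)) * (a * b - e) by move: h; lra.
by rewrite pmulr_rge0 ?subr_ge0 // mulr_gt0.
Qed.

Lemma enormD (R : realType) (d : nat) (x y : 'rV[R]_d) :
  enorm (x + y) <= enorm x + enorm y.
Proof.
have h : 0 <= enorm x + enorm y by rewrite addr_ge0 ?enorm_ge0.
rewrite -(ler_pXn2r (ltn0Sn 1)) ?nnegrE ?enorm_ge0 //.
rewrite enorm_sqr !edotE (edotC y x) -!enorm_sqr sqrrD.
by have := edot_le x y; lra.
Qed.

(** * Equilateral polygons *)

Lemma ordSE (N : nat) (i : 'I_N.+3) : ordS i = i + 1.
Proof. by apply/val_inj; rewrite /= modnDmr addn1. Qed.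

Lemma inZpS (N m : nat) : inZp m.+1 = inZp m + 1 :> 'I_N.+3.
Proof. by apply/val_inj => /=; rewrite modnDm addn1. Qed.

Lemma knot_lt_next (R : realType) (d N : nat) (P : polygon R d N.+3)
    (i : 'I_N.+3) :
  pknot P i < next_knot (pknot P) (plen P) i.
Proof.
rewrite /next_knot; case: ifP => hi.
  by apply: pknot_incr; rewrite /= modn_small.
have /andP[_ h1] := pknot_itv P i.
by have /andP[h2 _] := pknot_itv P (ordS i); apply: (lt_le_trans h1); lra.
Qed.

(** The unit direction of an edge is determined by its two endpoints. Hence on
    each edge the parametrization interpolates linearly between vertices, and the
    edge is as long as its parameter interval. *)
Lemma edge_point (R : realType) (d N : nat) (P : polygon R d N.+3)
    (i : 'I_N.+3) (t : R) :
  pknot P i <= t <= next_knot (pknot P) (plen P) i ->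
  Defs.pmap P t = vertex P i +
    ((t - pknot P i) / edge_length P i) *: (vertex P (i + 1) - vertex P i)
  /\ edge_length P i = next_knot (pknot P) (plen P) i - pknot P i.
Proof.
have hlt := knot_lt_next P i; have [u [u1 hu]] := pmap_edge P i.
set b := next_knot _ _ _ in hlt hu *.
have hb : Defs.pmap P b = vertex P (i + 1).
  by rewrite -ordSE /b /next_knot; case: ifP => // _; rewrite pmap_periodic.
have E : vertex P (i + 1) - vertex P i = (b - pknot P i) *: u.
  by rewrite -hb hu ?lexx ?ltW // addrAC subrr add0r.
have El : edge_length P i = b - pknot P i.
  by rewrite /edge_length ordSE E enormZ ?u1 ?mulr1 // subr_ge0 ltW.
move=> ht; split=> //; rewrite hu // E El scalerA divfK //.
by rewrite gt_eqF // subr_gt0.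
Qed.

Lemma edge_length_knot (R : realType) (d N : nat) (P : polygon R d N.+3)
    (i : 'I_N.+3) :
  edge_length P i = next_knot (pknot P) (plen P) i - pknot P i.
Proof.
have h := knot_lt_next P i.
have [|_ ->//] := @edge_point R d N P i (pknot P i).
by rewrite lexx ltW.
Qed.

Lemma edge_length_gt0 (R : realType) (d N : nat) (P : polygon R d N.+3)
    (i : 'I_N.+3) : 0 < edge_length P i.
Proof. by rewrite edge_length_knot subr_gt0 knot_lt_next. Qed.

Lemma vertex_inj (R : realType) (d N : nat) (P : polygon R d N.+3) :
  injective (vertex P).
Proof.
move=> i j h; have := pmap_embedded (pknot_itv P i) (pknot_itv P j) h => e.
apply/val_inj; case: (ltngtP (val i) (val j)) => // h'.
  by have := pknot_incr P h'; rewrite e ltxx.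
by have := pknot_incr P h'; rewrite e ltxx.
Qed.

Lemma equilateral_knot (R : realType) (d N : nat) (P : polygon R d N.+3)
    (i : 'I_N.+3) : equilateral P ->
  pknot P i = pknot P 0 + i%:R * edge_length P 0.
Proof.
move=> eqlP; set l := edge_length P 0.
have h (m : nat) : (m < N.+3)%N ->
    pknot P (inZp m) = pknot P 0 + m%:R * l.
  elim: m => [|m ih] hm.
    have -> : inZp 0 = 0 :> 'I_N.+3 by apply/val_inj.
    by rewrite mul0r addr0.
  have := edge_length_knot P (inZp m); rewrite (eqlP (inZp m) 0) -/l.
  rewrite /next_knot /= modn_small; last by lia.
  by rewrite hm ordSE -inZpS ih ?(ltnW hm) // -natr1 mulrDl mul1r; lra.
by rewrite -h // valZpK.
Qed.

Lemma equilateral_len (R : realType) (d N : nat) (P : polygon R d N.+3) :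
  equilateral P -> plen P = N.+3%:R * edge_length P 0.
Proof.
move=> eqlP; set l := edge_length P 0.
have := edge_length_knot P ord_max; rewrite (eqlP ord_max 0) -/l.
rewrite /next_knot /= ltnn ordSE.
have -> : ord_max + 1 = 0 :> 'I_N.+3.
  by apply/val_inj; rewrite /= modnDmr addn1 modnn.
rewrite (equilateral_knot ord_max eqlP) /= => h.
have -> : N.+3%:R = N.+2%:R + 1 :> R by rewrite natr1.
rewrite mulrDl mul1r; move: h; rewrite -/l.
by move: (N.+2%:R * l) (plen P) (pknot P 0) => a b c; lra.
Qed.

Definition ord_dist (N : nat) (k : 'I_N.+3) : nat := minn k (N.+3 - k).

(** Of the two arcs between vertices i and i + k one has k edges and the other
    n - k; which of them is the difference of the knots depends on whether the
    addition i + k wraps around. *)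
Lemma arc_dist_equilateral (R : realType) (d N : nat) (P : polygon R d N.+3)
    (i k : 'I_N.+3) : equilateral P ->
  arc_dist P (i + k) i = edge_length P 0 * (ord_dist k)%:R.
Proof.
move=> eqlP; have l0 := edge_length_gt0 P 0.
rewrite /arc_dist /circle_dist (equilateral_len eqlP).
rewrite (equilateral_knot (i + k) eqlP) (equilateral_knot i eqlP).
set l := edge_length P 0 in l0 *.
rewrite opprD addrACA subrr add0r -mulrBl normrM (gtr0_norm l0).
have hi := ltn_ord i; have hk := ltn_ord k.
have -> : l * (ord_dist k)%:R = Num.min (k%:R * l) ((N.+3 - k)%:R * l).
  rewrite mulrC /ord_dist; case: (leqP k (N.+3 - k)) => h.
    by rewrite min_l // ler_pM2r // ler_nat.
  by rewrite min_r // ler_pM2r // ler_nat ltnW.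
have natBE : (N.+3 - k)%:R = N.+3%:R - k%:R :> R by rewrite natrB // ltnW.
have [h|h] := ltnP (i + k) N.+3.
  rewrite /= modn_small // natrD addrAC subrr add0r normr_nat.
  by rewrite natBE mulrBl.
have e : val (i + k) = (i + k - N.+3)%N.
  rewrite /= -[X in (X %% _)%N](subnK h) modnDr modn_small //.
  by rewrite ltn_subLR //; lia.
rewrite -[nat_of_ord (i + k)]/(val (i + k)) e natrB // natrD.
have -> : i%:R + k%:R - N.+3%:R - i%:R = - (N.+3%:R - k%:R) :> R by ring.
rewrite normrN -natBE normr_nat minC -mulrBl natBE; congr (Num.min (_ * l) _).
by ring.
Qed.

Lemma chord_le_nat (R : realType) (d N : nat) (P : polygon R d N.+3)
    (i : 'I_N.+3) (m : nat) : equilateral P ->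
  enorm (vertex P (i + inZp m) - vertex P i) <= edge_length P 0 * m%:R.
Proof.
move=> eqlP; elim: m => [|m ih].
  have -> : inZp 0 = 0 :> 'I_N.+3 by apply/val_inj.
  by rewrite addr0 subrr mulr0 /enorm -(scale0r 0) edotZl mul0r sqrtr0.
have -> : vertex P (i + inZp m.+1) - vertex P i =
    (vertex P (i + inZp m + 1) - vertex P (i + inZp m))
    + (vertex P (i + inZp m) - vertex P i).
  by rewrite addrA subrK inZpS addrA.
rewrite (le_trans (enormD _ _)) // -natr1 mulrDr mulr1 addrC lerD //.
by rewrite -ordSE -/(edge_length P _) (eqlP _ 0).
Qed.

Lemma chord_le_arc (R : realType) (d N : nat) (P : polygon R d N.+3)
    (i k : 'I_N.+3) : equilateral P ->
  enorm (vertex P (i + k) - vertex P i)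
  <= edge_length P 0 * (ord_dist k)%:R.
Proof.
move=> eqlP; rewrite /ord_dist; case: (leqP k (N.+3 - k)) => _.
  by have := chord_le_nat i k eqlP; rewrite valZpK.
rewrite -enormN opprB.
have := chord_le_nat (i + k) (N.+3 - k) eqlP.
suff -> : i + k + inZp (N.+3 - k) = i by [].
have -> : inZp (N.+3 - k) = - k by apply/val_inj.
by rewrite addrK.
Qed.

(** Lengths measured in units of one edge remove the scale from the energy. *)
Definition unit_chord (R : realType) (d N : nat) (P : polygon R d N.+3)
    (i k : 'I_N.+3) : R :=
  enorm (vertex P (i + k) - vertex P i) / edge_length P 0.

Lemma unit_chord_itv (R : realType) (d N : nat) (P : polygon R d N.+3)
    (i k : 'I_N.+3) : equilateral P -> k != 0 ->
  0 < unit_chord P i k /\ unit_chord P i k <= (ord_dist k)%:R.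
Proof.
move=> eqlP k0; have l0 := edge_length_gt0 P 0; split; last first.
  by rewrite ler_pdivrMr // mulrC chord_le_arc.
rewrite divr_gt0 // lt_neqAle enorm_ge0 andbT eq_sym; apply/negP => /eqP h.
move/eqP: (enorm_eq0 h); rewrite subr_eq0 => /eqP /vertex_inj /eqP.
by rewrite -[X in _ == X]addr0 (inj_eq (addrI i)) (negbTE k0).
Qed.

Lemma powR_sub_scale (R : realType) (alpha q l y a : R) :
  0 < alpha -> 0 < l -> 0 < y -> y <= a ->
  (1 / (l * y) `^ alpha - 1 / (l * a) `^ alpha) `^ q
  = l `^ (- (alpha * q)) * pair_energy alpha q a y.
Proof.
move=> a0 l0 y0 ya; have ap := lt_le_trans y0 ya.
have -> : 1 / (l * y) `^ alpha - 1 / (l * a) `^ alpha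
    = l `^ (- alpha) * (1 / y `^ alpha - 1 / a `^ alpha).
  rewrite !powRM ?(ltW l0) ?(ltW y0) ?(ltW ap) // powRN !div1r.
  by rewrite mulrBr !invfM.
rewrite powRM ?powR_ge0 -?powRrM ?mulNr // subr_ge0.
move: ya; rewrite le_eqVlt => /orP[/eqP->//|ya].
by rewrite ltW // inv_powR_lt.
Qed.

(** The factor L^(alpha q - 2) is n^(alpha q - 2) l^(alpha q - 2) for edges of
    length l. The power of l cancels against l^(- alpha q), which comes from the
    distances, and against the two edge lengths. *)
Lemma energy_equilateral (R : realType) (d N : nat) (alpha q : R)
    (P : polygon R d N.+3) : 0 < alpha -> equilateral P ->
  energy alpha q P = alpha^-1 * N.+3%:R `^ (alpha * q - 2) *
    \sum_(k | k != 0) \sum_i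
      pair_energy alpha q (ord_dist k)%:R (unit_chord P i k).
Proof.
move=> a0 eqlP; rewrite /energy -!mulrA; congr (_ * _).
have l0 := edge_length_gt0 P 0; set l := edge_length P 0 in l0 *.
transitivity (plen P `^ (alpha * q - 2) * \sum_i \sum_(k | k != 0)
    (l `^ (- (alpha * q)) * (l * l)) *
      pair_energy alpha q (ord_dist k)%:R (unit_chord P i k)).
  congr (_ * _); apply: eq_bigr => i _.
  rewrite (reindex_onto (fun k => i + k) (fun j => j - i)) /=; last first.
    by move=> j _; rewrite addrC subrK.
  apply: eq_big => [k|k hk].
    rewrite [i + k]addrC addrK eqxx andbT -[X in X != _]add0r eq_sym.
    by rewrite (inj_eq (addIr i)).
  have k0 : k != 0.
    move: hk; rewrite [i + k]addrC addrK eqxx andbT -[X in X != _]add0r eq_sym.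
    by rewrite (inj_eq (addIr i)).
  rewrite (eqlP i 0) (eqlP (i + k) 0) arc_dist_equilateral // -/l.
  have [c0 c1] := unit_chord_itv i eqlP k0.
  have -> : enorm (vertex P (i + k) - vertex P i) = l * unit_chord P i k.
    by rewrite mulrC /unit_chord -/l divfK // gt_eqF.
  by rewrite powR_sub_scale //; ring.
rewrite exchange_big /=; under eq_bigr do rewrite -mulr_sumr.
rewrite -mulr_sumr mulrA; congr (_ * _).
rewrite (equilateral_len eqlP) -/l powRM ?(ltW l0) //.
rewrite -[l * l]expr2 -powR_mulrn ?(ltW l0) // -powRD; last first.
  by apply/implyP => _; rewrite gt_eqF.
rewrite -mulrA -powRD; last by apply/implyP => _; rewrite gt_eqF.
suff -> : alpha * q - 2 + (- (alpha * q) + 2%:R) = 0 by rewrite powRr0 mulr1.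
by ring.
Qed.

(** * Chords of the regular polygon *)

(** The length of the chord joining k-th neighbours in the regular polygon with
    edges of length one. *)
Definition regular_chord (R : realType) (N : nat) (k : 'I_N.+3) : R :=
  Num.sqrt ((1 - ordcos R k) / (1 - ordcos R (1 : 'I_N.+3))).

Lemma regular_chord_sqr (R : realType) (N : nat) (k : 'I_N.+3) :
  regular_chord R k ^+ 2 * (1 - ordcos R (1 : 'I_N.+3)) = 1 - ordcos R k.
Proof.
have h1 := ordcos1_lt1 R N; have hk := ordcos_le1 R k.
rewrite sqr_sqrtr ?divr_ge0 ?subr_ge0 ?(ltW h1) // divfK // gt_eqF //.
by rewrite subr_gt0.
Qed.

Lemma regular_chord_gt0 (R : realType) (N : nat) (k : 'I_N.+3) :
  k != 0 -> 0 < regular_chord R k.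
Proof.
move=> k0; have h1 := ordcos1_lt1 R N; have hk := ordcos_lt1 R k0.
by rewrite sqrtr_gt0 divr_gt0 ?subr_gt0.
Qed.

Lemma regular_chord_le (R : realType) (N : nat) (k : 'I_N.+3) :
  regular_chord R k <= (ord_dist k)%:R.
Proof.
have h1 : 0 < 1 - ordcos R (1 : 'I_N.+3) by rewrite subr_gt0 ordcos1_lt1.
rewrite -(ler_pXn2r (ltn0Sn 1)) ?nnegrE ?sqrtr_ge0 //.
rewrite -(ler_pM2r h1) regular_chord_sqr /ord_dist.
case: (leqP k (N.+3 - k)) => _.
  by have := one_sub_ordcos_le R N k; rewrite valZpK.
have := one_sub_ordcos_le R N (N.+3 - k).
have -> : inZp (N.+3 - k) = - k by apply/val_inj.
by rewrite ordcosN.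
Qed.

Lemma regular_chord2_lt (R : realType) (N : nat) : (0 < N)%N ->
  regular_chord R (1 + 1 : 'I_N.+3) < (ord_dist (1 + 1 : 'I_N.+3))%:R.
Proof.
move=> N0; have h1 : 0 < 1 - ordcos R (1 : 'I_N.+3).
  by rewrite subr_gt0 ordcos1_lt1.
have -> : ord_dist (1 + 1 : 'I_N.+3) = 2%N.
  by rewrite /ord_dist /= !modn_small //; apply/minn_idPl; lia.
rewrite -(ltr_pXn2r (ltn0Sn 1)) ?nnegrE ?sqrtr_ge0 //.
rewrite -(ltr_pM2r h1) regular_chord_sqr ordcos_double expr2 -!mulrA.
rewrite ltr_pM2l // mulrC ltr_pM2r //; lra.
Qed.

Lemma ordsin1_neq0 (R : realType) (N : nat) : ordsin R (1 : 'I_N.+3) != 0.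
Proof.
have hpi := pi_gt0 R.
rewrite -inZp1 ordsin_inZp; rewrite gt_eqF //; apply: sin_gt0_pi.
rewrite !mulr_gt0 ?invr_gt0 //= ltr_pdivrMr // mulr1 mulrC ltr_pM2l //.
by rewrite ltr_nat.
Qed.

(** * Closed sequences on an affine image of the circle *)

(** Chords between k-th neighbours depend on i through the doubled angle of the
    midpoint of the corresponding arc of the circle. *)
Lemma ellipse_chord (R : realType) (d N : nat) (A B : 'rV[R]_d)
    (i k : 'I_N.+3) :
  let v j := ordcos R j *: A + ordsin R j *: B in
  edot (v (i + k) - v i) (v (i + k) - v i) = (1 - ordcos R k) *
    (edot A A + edot B B - (edot A A - edot B B) * ordcos R (i + i + k)
     - 2 * edot A B * ordsin R (i + i + k)).
Proof.
move=> v; have -> : v (i + k) - v i = (ordcos R (i + k) - ordcos R i) *: A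
    + (ordsin R (i + k) - ordsin R i) *: B.
  by rewrite /v !scalerBl opprD addrACA.
rewrite !edotE (edotC B A).
have hi := ordcos2Dsin2 R i; have hk := ordcos2Dsin2 R k.
rewrite !ordcosD !ordsinD !ordcosD.
set a := edot A A; set b := edot B B; set e := edot A B.
move: (ordcos R i) (ordsin R i) (ordcos R k) (ordsin R k) hi hk => c s x y hi hk.
(* Both sides differ by a combination of the two Pythagorean relations. *)
pose K1 := x ^+ 2 + y ^+ 2 - 1; pose K2 := c ^+ 2 + s ^+ 2 - 1.
have K10 : K1 = 0 by rewrite /K1 hk subrr.
have K20 : K2 = 0 by rewrite /K2 hi subrr.
rewrite -[RHS]addr0 -[0](mul0r (a * s ^+ 2 + b * c ^+ 2 - 2 * e * c * s)) -{1}K10.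
rewrite -[LHS]addr0 -[X in _ + X = _](mul0r (- (a + b) * (1 - x))) -{1}K20.
by rewrite /K1 /K2; ring.
Qed.

(** Divided by 1 - cos k, the squared chord of the ellipse is a constant minus
    (X cos (2 i + k) + Y sin (2 i + k)), and that of the regular polygon does not
    depend on k. So X cos + Y sin takes one and the same value at -1, 0 and 1,
    namely for (i, k) = (-1, 1), (-1, 2) and (0, 1), which forces X = Y = 0. *)
Lemma ellipse_circle (R : realType) (d N : nat) (A B : 'rV[R]_d) (l : R) :
  let v (j : 'I_N.+3) := ordcos R j *: A + ordsin R j *: B in
  (forall i, edot (v (i + 1) - v i) (v (i + 1) - v i)
    = l ^+ 2 * regular_chord R (1 : 'I_N.+3) ^+ 2) ->
  (forall i, edot (v (i + (1 + 1)) - v i) (v (i + (1 + 1)) - v i)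
    = l ^+ 2 * regular_chord R (1 + 1 : 'I_N.+3) ^+ 2) ->
  edot A A = edot B B /\ edot A B = 0.
Proof.
move=> v h1 h2.
pose g (m : 'I_N.+3) :=
  (edot A A - edot B B) * ordcos R m + 2 * edot A B * ordsin R m.
have c1 : 0 < 1 - ordcos R (1 : 'I_N.+3) by rewrite subr_gt0 ordcos1_lt1.
pose e := edot A A + edot B B - l ^+ 2 / (1 - ordcos R (1 : 'I_N.+3)).
have key (i k : 'I_N.+3) : k != 0 ->
    edot (v (i + k) - v i) (v (i + k) - v i) = l ^+ 2 * regular_chord R k ^+ 2 ->
    g (i + i + k) = e.
  move=> k0; rewrite ellipse_chord => h.
  have ck : 0 < 1 - ordcos R k by rewrite subr_gt0 ordcos_lt1.
  apply: (mulfI (lt0r_neq0 ck)); rewrite /e mulrBr.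
  have -> : (1 - ordcos R k) * (l ^+ 2 / (1 - ordcos R (1 : 'I_N.+3)))
      = l ^+ 2 * regular_chord R k ^+ 2.
    by rewrite -(regular_chord_sqr R k); field; rewrite gt_eqF.
  by rewrite -h /g; ring.
have g0 : g 0 = e.
  by rewrite -(key (- 1) (1 + 1)) //; congr g; ring.
have g1 : g 1 = e.
  by rewrite -(key 0 1) //; congr g; ring.
have gN1 : g (- 1) = e.
  by rewrite -(key (- 1) 1) //; congr g; ring.
move: g0 g1 gN1; rewrite /g ordcosN ordsinN ordcos0 ordsin0 mulr1 mulr0 addr0.
have s1 := ordsin1_neq0 R N.
clear h1 h2 key g.
move: (edot A A) (edot B B) (edot A B) (ordcos R 1) (ordsin R 1) c1 @e s1.
move=> a b f c s c1 e s1; move: e => e g0 g1 gN1.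
have X0 : a - b = 0.
  apply/eqP; rewrite -(mulrI_eq0 _ (mulfI (lt0r_neq0 c1))).
  by rewrite mulrC mulrBr mulr1; apply/eqP; lra.
split; first by apply/eqP; rewrite -subr_eq0 X0.
have : f * s = 0 by move: g1 gN1; rewrite X0; lra.
by move/eqP; rewrite mulf_eq0 (negbTE s1) orbF => /eqP.
Qed.

(** * The lower bound for the energy and its equality case *)

Lemma sum_unit_chord_sqr (R : realType) (d N : nat) (P : polygon R d N.+3)
    (k : 'I_N.+3) :
  edge_length P 0 ^+ 2 * \sum_i unit_chord P i k ^+ 2
  = \sum_(c < d) chord_sum (fun i => vertex P i 0 c) k.
Proof.
have l0 : edge_length P 0 != 0 by rewrite gt_eqF // edge_length_gt0.
rewrite exchange_big mulr_sumr; apply: eq_bigr => i _.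
rewrite /unit_chord expr_div_n mulrCA divff ?expf_neq0 // mulr1 enorm_sqr.
by apply: eq_bigr => c _; rewrite !mxE expr2.
Qed.

Lemma unit_chord1 (R : realType) (d N : nat) (P : polygon R d N.+3)
    (i : 'I_N.+3) : equilateral P -> unit_chord P i 1 = 1.
Proof.
move=> eqlP; rewrite /unit_chord -ordSE -/(edge_length P i) (eqlP i 0).
by rewrite divff // gt_eqF // edge_length_gt0.
Qed.

Lemma unit_chord_gap (R : realType) (d N : nat) (P : polygon R d N.+3)
    (k : 'I_N.+3) : equilateral P ->
  edge_length P 0 ^+ 2 * (1 - ordcos R (1 : 'I_N.+3)) *
    (N.+3%:R * regular_chord R k ^+ 2 - \sum_i unit_chord P i k ^+ 2)
  = \sum_(c < d) chord_gap (fun i => vertex P i 0 c) k.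
Proof.
move=> eqlP; have := sum_unit_chord_sqr P 1.
rewrite (eq_bigr (fun=> 1)) => [|i _]; last by rewrite unit_chord1 ?expr1n.
rewrite sumr_const card_ord => h1; have hk := sum_unit_chord_sqr P k.
rewrite /chord_gap sumrB -!mulr_sumr -h1 -hk -(regular_chord_sqr R k).
by ring.
Qed.

Lemma sum_unit_chord_le (R : realType) (d N : nat) (P : polygon R d N.+3)
    (k : 'I_N.+3) : equilateral P ->
  \sum_i unit_chord P i k ^+ 2 <= N.+3%:R * regular_chord R k ^+ 2.
Proof.
move=> eqlP; rewrite -subr_ge0.
have h : 0 < edge_length P 0 ^+ 2 * (1 - ordcos R (1 : 'I_N.+3)).
  by rewrite mulr_gt0 ?exprn_gt0 ?edge_length_gt0 // subr_gt0 ordcos1_lt1.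
rewrite -(pmulr_rge0 _ h) unit_chord_gap // sumr_ge0 // => c _.
exact: chord_gap_ge0.
Qed.

(** Summing the tangent inequality over i, the linear term has the right sign
    because the slope is nonpositive and the squared chords are on average at
    most those of the regular polygon. *)
Lemma sum_pair_energy_ge (R : realType) (d N : nat) (alpha q : R)
    (P : polygon R d N.+3) (k : 'I_N.+3) : 0 < alpha -> 1 <= q ->
  equilateral P -> k != 0 ->
  let e := pair_energy alpha q (ord_dist k)%:R in
  \sum_(i < N.+3) e (regular_chord R k) <= \sum_i e (unit_chord P i k) /\
  (regular_chord R k < (ord_dist k)%:R ->
   \sum_i e (unit_chord P i k) <= \sum_(i < N.+3) e (regular_chord R k) ->
   forall i, unit_chord P i k = regular_chord R k).
Proof.
move=> a0 q1 eqlP k0 e.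
have [s s0 hs] := pair_energy_tangent a0 q1 (regular_chord_gt0 R k0)
  (regular_chord_le R k).
set rho := regular_chord R k in hs *.
pose t i := e rho - s * (unit_chord P i k ^+ 2 - rho ^+ 2).
have ht : \sum_(i < N.+3) e rho <= \sum_i t i.
  rewrite sumrB lerBrDr gerDl -mulr_sumr sumrB sumr_const card_ord.
  rewrite mulr_ge0_le0 // subr_le0 -mulr_natl.
  exact: sum_unit_chord_le.
have hle i : t i <= e (unit_chord P i k).
  have [c0 c1] := unit_chord_itv i eqlP k0.
  by have [] := hs _ c0 c1.
split; first by apply: (le_trans ht); apply: ler_sum => i _.
move=> hrho hsum i; apply/eqP/negPn/negP => ne.
have [c0 c1] := unit_chord_itv i eqlP k0.
have [_ /(_ hrho ne) hlt] := hs _ c0 c1.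
have : \sum_i t i < \sum_i e (unit_chord P i k).
  rewrite (bigD1 i isT) [ltRHS](bigD1 i isT) /=.
  by apply: ltr_leD; [exact: hlt | apply: ler_sum => j _; exact: hle].
by rewrite ltNge (le_trans hsum ht).
Qed.

Definition regular_energy (R : realType) (N : nat) (alpha q : R) : R :=
  alpha^-1 * N.+3%:R `^ (alpha * q - 2) *
    \sum_(k : 'I_N.+3 | k != 0) \sum_(i < N.+3)
      pair_energy alpha q (ord_dist k)%:R (regular_chord R k).

Lemma energy_factor_gt0 (R : realType) (N : nat) (alpha q : R) : 0 < alpha ->
  0 < alpha^-1 * N.+3%:R `^ (alpha * q - 2).
Proof. by move=> a0; rewrite mulr_gt0 ?invr_gt0 ?powR_gt0. Qed.

Lemma regular_energy_le (R : realType) (d N : nat) (alpha q : R)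
    (P : polygon R d N.+3) : 0 < alpha -> 1 <= q -> equilateral P ->
  regular_energy N alpha q <= energy alpha q P.
Proof.
move=> a0 q1 eqlP; rewrite (energy_equilateral q a0 eqlP).
apply: ler_wpM2l; first exact: ltW (energy_factor_gt0 N q a0).
by apply: ler_sum => k k0; have [h _] := sum_pair_energy_ge a0 q1 eqlP k0.
Qed.

Lemma ler_sum_eq (R : realType) (I : finType) (A : pred I) (f g : I -> R) :
  (forall i, A i -> f i <= g i) -> \sum_(i | A i) g i <= \sum_(i | A i) f i ->
  forall i, A i -> g i <= f i.
Proof.
move=> hfg hle i hi; have := hle.
rewrite (bigD1 i hi) [leRHS](bigD1 i hi) /= => h.
rewrite -(lerD2r (\sum_(j | A j && (j != i)) g j)); apply: (le_trans h).
by rewrite lerD2l; apply: ler_sum => j /andP[hj _]; exact: hfg.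
Qed.

(** In a triangle second neighbours are first neighbours. Otherwise the chord
    is shorter than the arc and the tangent inequality is strict. *)
Lemma energy_le_unit_chord2 (R : realType) (d N : nat) (alpha q : R)
    (P : polygon R d N.+3) : 0 < alpha -> 1 <= q -> equilateral P ->
  energy alpha q P <= regular_energy N alpha q ->
  forall i, unit_chord P i (1 + 1) = regular_chord R (1 + 1 : 'I_N.+3).
Proof.
move=> a0 q1 eqlP; rewrite (energy_equilateral q a0 eqlP) /regular_energy.
rewrite (ler_pM2l (energy_factor_gt0 N q a0)).
move=> hle i; case: N P eqlP hle i => [|N] P eqlP hle i.
  have e2 : 1 + 1 = - 1 :> 'I_3 by apply/val_inj.
  rewrite e2 /regular_chord ordcosN divff ?sqrtr1; last first.
    by rewrite gt_eqF // subr_gt0 ordcos1_lt1.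
  rewrite -(unit_chord1 (i - 1) eqlP) /unit_chord subrK -enormN opprB //.
have k0 : 1 + 1 != 0 :> 'I_N.+4 by [].
have [_] := sum_pair_energy_ge a0 q1 eqlP k0.
apply; first exact: regular_chord2_lt.
apply: (ler_sum_eq _ hle k0) => k k1.
by have [h _] := sum_pair_energy_ge a0 q1 eqlP k1.
Qed.

(** The gaps of the coordinates are nonnegative and add up to zero, so each
    coordinate is a constant plus a first Fourier mode. The polygon is therefore
    inscribed in an affine image of a circle, which its first and second chords
    show to be round. *)
Lemma unit_chord2_regular (R : realType) (d N : nat) (P : polygon R d N.+3) :
  equilateral P ->
  (forall i, unit_chord P i (1 + 1) = regular_chord R (1 + 1 : 'I_N.+3)) ->
  regular_polygon P.
Proof.
move=> eqlP h2; have l0 := edge_length_gt0 P 0.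
have c1 : 0 < 1 - ordcos R (1 : 'I_N.+3) by rewrite subr_gt0 ordcos1_lt1.
have hgap : forall c : 'I_d, chord_gap (fun i => vertex P i 0 c) (1 + 1) = 0.
  have := unit_chord_gap (1 + 1) eqlP.
  under eq_bigr do rewrite h2.
  rewrite sumr_const card_ord mulr_natl subrr mulr0 => /esym/eqP.
  rewrite psumr_eq0 => [/allP h c|c _]; last exact: chord_gap_ge0.
  by apply/eqP; exact: h (mem_index_enum c).
have hex (c : 'I_d) : exists p : R * R * R, forall i,
    vertex P i 0 c = p.1.1 + p.1.2 * ordcos R i + p.2 * ordsin R i.
  by have [a [b [e h]]] := chord_gap2_eq0 (hgap c); exists (a, b, e).
have [p hp] := fin_all_exists hex.
pose C := \row_(c < d) (p c).1.1; pose A := \row_(c < d) (p c).1.2.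
pose B := \row_(c < d) (p c).2.
pose v (j : 'I_N.+3) := ordcos R j *: A + ordsin R j *: B.
have hV i : vertex P i = C + v i.
  by apply/rowP => c; rewrite hp !mxE; ring.
have hv i k : edot (v (i + k) - v i) (v (i + k) - v i)
    = edge_length P 0 ^+ 2 * unit_chord P i k ^+ 2.
  have -> : v (i + k) - v i = vertex P (i + k) - vertex P i.
    by rewrite !hV (opprD C (v i)) addrACA subrr add0r.
  by rewrite -enorm_sqr -exprMn mulrC divfK // gt_eqF.
have r1 : regular_chord R (1 : 'I_N.+3) = 1.
  by rewrite /regular_chord divff ?sqrtr1 // gt_eqF.
have [AB AB0] : edot A A = edot B B /\ edot A B = 0.
  apply: (@ellipse_circle R d N A B (edge_length P 0)) => i.
    by rewrite -/v hv unit_chord1 // r1.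
  by rewrite -/v hv h2.
have hA : 0 < enorm A.
  rewrite lt_neqAle enorm_ge0 andbT eq_sym; apply/negP => /eqP A0.
  have := hv 0 1; rewrite ellipse_chord -AB AB0 -enorm_sqr A0 unit_chord1 //.
  rewrite expr0n /= !(mulr0, mul0r, subr0, addr0, expr1n, mulr1).
  by move/esym/eqP; rewrite sqrf_eq0 gt_eqF.
have BA : enorm B = enorm A by rewrite /enorm AB.
have unitE (X : 'rV[R]_d) : enorm X = enorm A -> enorm ((enorm A)^-1 *: X) = 1.
  by move=> h; rewrite enormZ ?invr_ge0 ?(ltW hA) // h mulVf // gt_eqF.
exists C, ((enorm A)^-1 *: A), ((enorm A)^-1 *: B), (enorm A).
split; [by [] | exact: unitE | exact: unitE | by rewrite !edotE AB0 !mulr0 |].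
have sc (x : R) (X : 'rV[R]_d) :
    (enorm A * x) *: ((enorm A)^-1 *: X) = x *: X.
  by rewrite scalerA mulrAC divff ?mul1r // gt_eqF.
by move=> i; rewrite hV !sc addrA.
Qed.

Lemma regular_unit_chord (R : realType) (d N : nat) (P : polygon R d N.+3) :
  regular_polygon P ->
  equilateral P /\ forall i k, unit_chord P i k = regular_chord R k.
Proof.
move=> [C [u [w [r [r0 u1 w1 uw hV]]]]].
have c1 : 0 < 1 - ordcos R (1 : 'I_N.+3) by rewrite subr_gt0 ordcos1_lt1.
pose a := r * Num.sqrt (2 * (1 - ordcos R (1 : 'I_N.+3))).
have a0 : 0 < a by rewrite mulr_gt0 // sqrtr_gt0 mulr_gt0.
have hc i k : enorm (vertex P (i + k) - vertex P i) = a * regular_chord R k.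
  apply: enorm_eq_edot; first by rewrite mulr_ge0 ?sqrtr_ge0 // ltW.
  pose v (j : 'I_N.+3) := ordcos R j *: (r *: u) + ordsin R j *: (r *: w).
  have hv j : vertex P j = C + v j.
    by rewrite hV /v !scalerA addrA ![_ * r]mulrC.
  have -> : vertex P (i + k) - vertex P i = v (i + k) - v i.
    by rewrite !hv opprD addrACA subrr add0r.
  rewrite ellipse_chord !edotE uw -!enorm_sqr u1 w1 expr1n !mulr0 mul0r subr0.
  rewrite !mulr1 subrr mul0r subr0 exprMn -(regular_chord_sqr R k).
  have a2 : a ^+ 2 = r ^+ 2 * (2 * (1 - ordcos R (1 : 'I_N.+3))).
    by rewrite exprMn sqr_sqrtr // mulr_ge0 // ltW.
  by rewrite a2; ring.
have r1 : regular_chord R (1 : 'I_N.+3) = 1.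
  by rewrite /regular_chord divff ?sqrtr1 // gt_eqF.
have hl i : edge_length P i = a.
  by rewrite /edge_length ordSE hc r1 mulr1.
split=> [i j|i k]; first by rewrite !hl.
by rewrite /unit_chord hc hl mulrC mulKf // gt_eqF.
Qed.

Lemma energy_regular (R : realType) (d N : nat) (alpha q : R)
    (P : polygon R d N.+3) : 0 < alpha -> regular_polygon P ->
  energy alpha q P = regular_energy N alpha q.
Proof.
move=> a0 /regular_unit_chord[eqlP h]; rewrite (energy_equilateral q a0 eqlP).
by under eq_bigr do under eq_bigr do rewrite h.
Qed.

(** One regular polygon is needed for the lower bound to be known as the value of
    a minimizer. *)
Lemma minimizer_iff_regular (R : realType) (d N : nat) (alpha q : R)
    (P0 P : polygon R d N.+3) : 0 < alpha -> 1 <= q -> regular_polygon P0 ->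
  equilateral_minimizer alpha q P <-> regular_polygon P.
Proof.
move=> a0 q1 reg0; split=> [[eqlP hmin]|reg].
  apply: unit_chord2_regular => //.
  apply: (energy_le_unit_chord2 a0 q1 eqlP).
  rewrite -(energy_regular q a0 reg0); apply: hmin.
  by have [] := regular_unit_chord reg0.
have [eqlP _] := regular_unit_chord reg; split=> // Q eqlQ.
by rewrite (energy_regular q a0 reg) regular_energy_le.
Qed.

(** * Existence of a regular polygon *)

(** The integer part of the time is reduced modulo n as an integer, so that the
    map is periodic on the whole real line. *)
Definition broken_line (R : realType) (d N : nat) (V : 'I_N.+3 -> 'rV[R]_d)
    (t : R) : 'rV[R]_d :=
  let k : 'I_N.+3 := inZp `|(Num.floor t %% N.+3)%Z|%N in
  V k + (t - (Num.floor t)%:~R) *: (V (k + 1) - V k).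

Lemma broken_line_edge (R : realType) (d N : nat) (V : 'I_N.+3 -> 'rV[R]_d)
    (m : nat) (t : R) : m%:R <= t <= m%:R + 1 ->
  broken_line V t =
  V (inZp m) + (t - m%:R) *: (V (inZp m + 1) - V (inZp m)).
Proof.
have main (p : nat) (s : R) : p%:R <= s < p%:R + 1 -> broken_line V s =
    V (inZp p) + (s - p%:R) *: (V (inZp p + 1) - V (inZp p)).
  move=> hs; have e : Num.floor s = p%:Z.
    by apply: floor_def; rewrite intrD.
  rewrite /broken_line e modz_nat absz_nat.
  have -> : inZp (p %% N.+3) = inZp p :> 'I_N.+3.
    by apply/val_inj; rewrite /= modn_mod.
  by [].
(* At the right end of the edge the floor already names the next edge. *)
move=> /andP[h1]; rewrite le_eqVlt => /orP[/eqP e|h2]; last first.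
  by apply: main; rewrite h1.
rewrite e (main m.+1); last by rewrite -natr1 lexx ltrDl ltr01.
rewrite -natr1 subrr scale0r addr0 inZpS.
by rewrite (addrC m%:R 1) addrK scale1r [RHS]addrC subrK.
Qed.

Lemma broken_line_knot (R : realType) (d N : nat) (V : 'I_N.+3 -> 'rV[R]_d)
    (i : 'I_N.+3) : broken_line V i%:R = V i.
Proof.
rewrite (@broken_line_edge R d N V i); last by rewrite lexx lerDl ler01.
by rewrite subrr scale0r addr0 valZpK.
Qed.

Lemma broken_line_periodic (R : realType) (d N : nat)
    (V : 'I_N.+3 -> 'rV[R]_d) (t : R) :
  broken_line V (t + N.+3%:R) = broken_line V t.
Proof.
have e : Num.floor (t + N.+3%:R) = Num.floor t + N.+3%:Z.
  apply: floor_def; have /andP[h1 h2] := floor_itv t.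
  rewrite !intrD /= in h2 *.
  by rewrite lerD2r h1 /= addrAC ltrD2r.
rewrite /broken_line e modzDr intrD /=.
by rewrite [in X in _ + X *: _](_ : _ - _ = t - (Num.floor t)%:~R) //; ring.
Qed.

Lemma next_knot_nat (R : realType) (N : nat) (i : 'I_N.+3) :
  next_knot (fun j : 'I_N.+3 => j%:R) N.+3%:R i = i%:R + 1 :> R.
Proof.
rewrite /next_knot; have hi := ltn_ord i; case: ifP => h /=.
  by rewrite modn_small // natr1.
have -> : i.+1 = N.+3 by lia.
by rewrite modnn add0r natr1; congr (_%:R); lia.
Qed.

Lemma floor_ord (R : realType) (N : nat) (t : R) : 0 <= t < N.+3%:R ->
  exists k : 'I_N.+3, k%:R <= t < k%:R + 1.
Proof.
move=> /andP[t0 tn]; have /andP[h1 h2] := floor_itv t.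
have f0 : 0 <= Num.floor t by rewrite floor_ge0.
case: (Num.floor t) f0 h1 h2 => // m _ h1 h2.
have hm : (m < N.+3)%N by rewrite -(ltr_nat R) (le_lt_trans h1).
by exists (Ordinal hm) => /=; rewrite h1; move: h2; rewrite intrD.
Qed.

Lemma polygon_of_vertices (R : realType) (d N : nat)
    (V : 'I_N.+3 -> 'rV[R]_d) :
  (forall i, enorm (V (i + 1) - V i) = 1) ->
  (forall k m (x y : R), 0 <= x < 1 -> 0 <= y < 1 ->
    V k + x *: (V (k + 1) - V k) = V m + y *: (V (m + 1) - V m) ->
    k = m /\ x = y) ->
  exists P : polygon R d N.+3, forall i, vertex P i = V i.
Proof.
move=> hV hS; pose a (i : 'I_N.+3) : R := i%:R.
have L0 : 0 < N.+3%:R :> R by [].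
have per t : broken_line V (t + N.+3%:R) = broken_line V t.
  exact: broken_line_periodic.
have emb s t : 0 <= s < N.+3%:R -> 0 <= t < N.+3%:R ->
    broken_line V s = broken_line V t -> s = t.
  move=> /floor_ord[k hk] /floor_ord[m hm].
  rewrite (@broken_line_edge R d N V k); last by case/andP: hk => -> /ltW ->.
  rewrite (@broken_line_edge R d N V m); last by case/andP: hm => -> /ltW ->.
  rewrite !valZpK => /hS []; first by lra.
    by lra.
  by move=> -> h; lra.
have itv i : 0 <= a i < N.+3%:R by rewrite /a ler0n ltr_nat ltn_ord.
have incr (i j : 'I_N.+3) : (i < j)%N -> a i < a j by rewrite /a ltr_nat.
have edge i : exists u : 'rV[R]_d, enorm u = 1 /\
    forall t, a i <= t <= next_knot a N.+3%:R i ->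
      broken_line V t = broken_line V (a i) + (t - a i) *: u.
  exists (V (i + 1) - V i); split=> // t; rewrite next_knot_nat => ht.
  by rewrite broken_line_knot (broken_line_edge V ht) valZpK.
exists (Polygon L0 per emb itv incr edge) => i.
exact: broken_line_knot.
Qed.

Lemma ordcos_pair_le (R : realType) (N : nat) (a : 'I_N.+3) :
  ordcos R a + ordcos R (a + 1) <= 1 + ordcos R (1 : 'I_N.+3)
    ?= iff (a == 0) || (a == - 1).
Proof.
have h1 := ordcos1_lt1 R N.
have [->|a0] := eqVneq a 0; first
  by rewrite add0r ordcos0; split; rewrite ?eqxx.
have [->|a1] := eqVneq a (- 1).
  by rewrite addNr ordcos0 ordcosN addrC; split; rewrite ?eqxx.
have a1' : a + 1 != 0 by rewrite -(subr_eq0 a) opprK in a1.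
have [l1 _] := ordcos_le_ordcos1 R a0; have [l2 _] := ordcos_le_ordcos1 R a1'.
have h : ordcos R a + ordcos R (a + 1) < 1 + ordcos R (1 : 'I_N.+3) by lra.
by split; [exact: ltW | rewrite lt_eqF].
Qed.

Lemma circle_edge (R : realType) (d N : nat) (V : 'I_N.+3 -> 'rV[R]_d)
    (b : R) : (forall i j, edot (V i) (V j) = b * ordcos R (i - j)) ->
  forall i, edot (V (i + 1) - V i) (V (i + 1) - V i)
    = b * (2 * (1 - ordcos R (1 : 'I_N.+3))).
Proof.
move=> hV i; rewrite !edotBl !edotBr !hV !subrr ordcos0.
have -> : i + 1 - i = 1 by ring.
have -> : i - (i + 1) = - 1 by ring.
by rewrite ordcosN; ring.
Qed.

(** The line through two consecutive vertices supports the polygon: the sum of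
    these vertices is normal to it, and no other vertex lies on it. *)
Lemma circle_edges_disjoint (R : realType) (d N : nat) (V : 'I_N.+3 -> 'rV[R]_d)
    (b : R) : 0 < b ->
  (forall i j, edot (V i) (V j) = b * ordcos R (i - j)) ->
  forall k m (x y : R), 0 <= x < 1 -> 0 <= y < 1 ->
    V k + x *: (V (k + 1) - V k) = V m + y *: (V (m + 1) - V m) ->
    k = m /\ x = y.
Proof.
move=> b0 hV.
have c1 := ordcos1_lt1 R N.
have edot_edge := circle_edge hV.
have normal k m : edot (V k + V (k + 1)) (V m)
    = b * (ordcos R (k - m) + ordcos R (k - m + 1)).
  by rewrite edotDl !hV mulrDr [k + 1 - m]addrAC.
have meet k m (x y : R) : 0 <= x < 1 -> 0 <= y < 1 ->
    V k + x *: (V (k + 1) - V k) = V m + y *: (V (m + 1) - V m) ->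
    m = k \/ m = k + 1.
  move=> hx hy /(congr1 (edot (V k + V (k + 1)))).
  have nk : edot (V k + V (k + 1)) (V k) = b * (1 + ordcos R (1 : 'I_N.+3)).
    by rewrite normal subrr add0r ordcos0.
  have nk1 : edot (V k + V (k + 1)) (V (k + 1))
      = b * (1 + ordcos R (1 : 'I_N.+3)).
    have e : k - (k + 1) = - 1 by ring.
    by rewrite normal e addNr ordcos0 ordcosN addrC.
  rewrite !(edotDr, edotNr, edotZr) nk nk1 !normal.
  have [l1 e1] := ordcos_pair_le R (k - m).
  have [l2 _] := ordcos_pair_le R (k - (m + 1)).
  move=> E.
  suff : (k - m == 0) || (k - m == - 1).
    case/orP=> /eqP h; first by left; apply/eqP; rewrite eq_sym -subr_eq0 h.
    by right; rewrite -[k](subrK m) h; ring.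
  rewrite -e1 eq_le l1 /=; move: E l2.
  set f1 := _ + ordcos R (k - m + 1); set f2 := ordcos R _ + ordcos R _.
  set g := 1 + ordcos R 1 => E l2.
  have E' : g = (1 - y) * f1 + y * f2.
    by apply: (mulfI (lt0r_neq0 b0)); move: E; lra.
  have h : (1 - y) * g <= (1 - y) * f1.
    have : y * f2 <= y * g by rewrite ler_wpM2l //; lra.
    by move: E'; lra.
  by rewrite -(ler_pM2l (_ : 0 < 1 - y)) //; lra.
move=> k m x y hx hy E.
(* If the edges were different, each would be the successor of the other, and
   n would be 2. *)
have km : k = m.
  have [->//|mk] := meet k m x y hx hy E.
  have [//|km] := meet m k y x hy hx (esym E).
  have : 1 + 1 = 0 :> 'I_N.+3.
    by apply: (addrI k); rewrite addr0 addrA -mk -km.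
  by move/eqP; rewrite (negbTE (ord2_neq0 N)).
split=> //; move: E; rewrite -km => /addrI /eqP.
rewrite -subr_eq0 -scalerBl scaler_eq0 subr_eq0 => /orP[/eqP//|/eqP h].
have : edot (V (k + 1) - V k) (V (k + 1) - V k) = 0.
  by rewrite h -(scale0r 0) edotZl mul0r.
rewrite edot_edge => h'.
have : b * (1 - ordcos R (1 : 'I_N.+3)) = 0 by lra.
by move/eqP; rewrite mulf_eq0 gt_eqF //= subr_eq0 eq_sym lt_eqF.
Qed.

Lemma edot_delta (R : realType) (d : nat) (i j : 'I_d) :
  edot (delta_mx 0 i : 'rV[R]_d) (delta_mx 0 j) = (i == j)%:R.
Proof.
rewrite /edot (bigD1 i) //= big1 => [|k hk]; last first.
  by rewrite !mxE eqxx /= (negbTE hk) mul0r.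
by rewrite !mxE !eqxx /= mul1r addr0.
Qed.

(** The radius makes the edges unit vectors, so that the broken line through the
    vertices is parametrized by arc-length. *)
Lemma regular_polygon_exists (R : realType) (d N : nat) : (2 <= d)%N ->
  exists P : polygon R d N.+3, regular_polygon P.
Proof.
case: d => [|[|d]] // _.
have c1 : 0 < 1 - ordcos R (1 : 'I_N.+3) by rewrite subr_gt0 ordcos1_lt1.
pose r := Num.sqrt ((2 * (1 - ordcos R (1 : 'I_N.+3)))^-1).
have r0 : 0 < r by rewrite sqrtr_gt0 invr_gt0 mulr_gt0.
have r2 : r ^+ 2 * (2 * (1 - ordcos R (1 : 'I_N.+3))) = 1.
  rewrite sqr_sqrtr ?mulVf ?gt_eqF ?mulr_gt0 //.
  by rewrite invr_ge0 mulr_ge0 // ltW.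
pose u : 'rV[R]_d.+2 := delta_mx 0 0; pose w : 'rV[R]_d.+2 := delta_mx 0 1.
have uu : edot u u = 1 by rewrite edot_delta.
have ww : edot w w = 1 by rewrite edot_delta.
have uw : edot u w = 0 by rewrite edot_delta.
pose V (i : 'I_N.+3) := (r * ordcos R i) *: u + (r * ordsin R i) *: w.
have hV i j : edot (V i) (V j) = r ^+ 2 * ordcos R (i - j).
  by rewrite !edotE uu ww (edotC w u) uw ordcosB; ring.
have [||P hP] := @polygon_of_vertices R d.+2 N V.
- move=> i; apply: enorm_eq_edot => //.
  by rewrite (circle_edge hV) expr1n r2.
- by apply: (circle_edges_disjoint (b := r ^+ 2)) => //; rewrite exprn_gt0.
exists P, 0, u, w, r; split=> //.
- by rewrite /enorm uu sqrtr1.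
- by rewrite /enorm ww sqrtr1.
by move=> i; rewrite hP add0r.
Qed.

(** * Regular polygons are similar *)

(** Reflection in the hyperplane that bisects x and y. When x = y the normal
    vector is zero, the quotient is zero by convention, and the map is the
    identity. *)
Lemma isometry_unit_vectors (R : realType) (d : nat) (x y : 'rV[R]_d) :
  edot x x = 1 -> edot y y = 1 ->
  exists H : 'rV[R]_d -> 'rV[R]_d,
    [/\ forall a b, H (a + b) = H a + H b,
        forall s a, H (s *: a) = s *: H a,
        forall a b, edot (H a) (H b) = edot a b,
        H x = y &
        forall z, edot z x = 0 -> edot z y = 0 -> H z = z].
Proof.
move=> xx yy; pose v := x - y.
have vv : edot v v = 2 * (1 - edot x y).
  by rewrite !edotE xx yy (edotC y x); ring.
have xv : edot x v = 1 - edot x y by rewrite edotBr xx.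
exists (fun z => z - (2 * edot z v / edot v v) *: v); split.
- move=> a b; rewrite edotDl mulrDr mulrDl scalerDl opprD.
  by rewrite addrACA.
- move=> s a /=; rewrite edotZl [RHS]scalerBr scalerA.
  by congr (_ - _ *: _); ring.
- clear vv xv; move: v => v a b /=; rewrite !edotE (edotC v b).
  have [v0|v0] := eqVneq (edot v v) 0; last by field.
  by rewrite v0 invr0 !(mulr0, mul0r) !subr0.
- have [v0|v0] := eqVneq (edot v v) 0.
    rewrite v0 invr0 mulr0 scale0r subr0.
    by apply/eqP; rewrite -subr_eq0; apply/eqP; apply: edot_eq0.
  have -> : 2 * edot x v / edot v v = 1 by rewrite xv -vv divff.
  by rewrite scale1r subKr.
- by move=> z zx zy; rewrite edotBr zx zy subr0 mulr0 mul0r scale0r subr0.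
Qed.

(** Two reflections, the second of which exchanges the image of w under the first
    and w'; both are orthogonal to u', which stays in place. *)
Lemma isometry_orthonormal_pairs (R : realType) (d : nat)
    (u w u' w' : 'rV[R]_d) :
  edot u u = 1 -> edot w w = 1 -> edot u w = 0 ->
  edot u' u' = 1 -> edot w' w' = 1 -> edot u' w' = 0 ->
  exists H : 'rV[R]_d -> 'rV[R]_d,
    [/\ forall a b, H (a + b) = H a + H b,
        forall s a, H (s *: a) = s *: H a,
        forall a b, edot (H a) (H b) = edot a b,
        H u = u' & H w = w'].
Proof.
move=> uu ww uw uu' ww' uw'.
have [H [HD HZ He Hu _]] := isometry_unit_vectors uu uu'.
have Hww : edot (H w) (H w) = 1 by rewrite He.
have [G [GD GZ Ge Gw Gz]] := isometry_unit_vectors Hww ww'.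
exists (G \o H); split=> /=.
- by move=> a b; rewrite HD GD.
- by move=> s a; rewrite HZ GZ.
- by move=> a b; rewrite Ge He.
- by rewrite Hu Gz // -Hu He.
- exact: Gw.
Qed.

Lemma pmap_periodic_int (R : realType) (d n : nat) (P : polygon R d n) (t : R)
    (z : int) : Defs.pmap P (t + z%:~R * plen P) = Defs.pmap P t.
Proof.
have nat_per (m : nat) (s : R) : Defs.pmap P (s + m%:R * plen P) = Defs.pmap P s.
  elim: m => [|m ih]; first by rewrite mul0r addr0.
  by rewrite -natr1 mulrDl mul1r addrA pmap_periodic ih.
case: z => m; first exact: nat_per.
rewrite NegzE -[RHS](nat_per m.+1) -[in RHS](nat_per m.+1) nat_per.
by rewrite -(nat_per m.+1) rmorphN mulNr subrK.
Qed.

Lemma range_pmap (R : realType) (d N : nat) (P : polygon R d N.+3)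
    (x : 'rV[R]_d) : equilateral P ->
  (exists t, Defs.pmap P t = x) <->
  exists i (s : R), 0 <= s <= 1 /\
    x = vertex P i + s *: (vertex P (i + 1) - vertex P i).
Proof.
move=> eqlP; have l0 := edge_length_gt0 P 0.
have nextE i : next_knot (pknot P) (plen P) i = pknot P i + edge_length P 0.
  by have := edge_length_knot P i; rewrite (eqlP i 0); lra.
split=> [[t <-]|[i [s [hs ->]]]]; last first.
  exists (pknot P i + s * edge_length P 0).
  have [|-> _] := @edge_point R d N P i (pknot P i + s * edge_length P 0).
    rewrite nextE lerDl lerD2l mulr_ge0 ?ler_piMl ?(ltW l0) //.
      by case/andP: hs.
    by case/andP: hs.
  by rewrite (eqlP i 0) addrAC subrr add0r mulfK // gt_eqF.
(* Move t into the period that starts at the first knot. *)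
pose l := edge_length P 0; pose z := Num.floor ((t - pknot P 0) / plen P).
have L0 := plen_gt0 P.
have /andP[z1 z2] := floor_itv ((t - pknot P 0) / plen P).
rewrite ler_pdivlMr // in z1; rewrite ltr_pdivrMr // intrD mulrDl mul1r in z2.
rewrite -(pmap_periodic_int P t (- z)) rmorphN mulNr.
set t1 := t - _; have t1z : t = t1 + z%:~R * plen P by rewrite subrK.
have h1 : 0 <= (t1 - pknot P 0) / l < N.+3%:R.
  rewrite ler_pdivlMr // ltr_pdivrMr // -equilateral_len // mul0r.
  by move: z1 z2; rewrite -/z t1z; lra.
have [k /andP[k1 k2]] := floor_ord h1.
rewrite ler_pdivlMr // in k1; rewrite ltr_pdivrMr // mulrDl mul1r in k2.
have [|-> _] := @edge_point R d N P k t1.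
  rewrite nextE (equilateral_knot k eqlP) -/l.
  by apply/andP; split; lra.
exists k, ((t1 - pknot P k) / edge_length P k); split=> //.
rewrite (eqlP k 0) (equilateral_knot k eqlP) -/l.
by rewrite ler_pdivlMr // ler_pdivrMr // mul0r mul1r; apply/andP; split; lra.
Qed.

(** The similarity that matches centres, frames and radii matches the vertices.
    It is affine, so it matches the edges as well, and these cover the polygons. *)
Lemma regular_polygons_similar (R : realType) (d N : nat)
    (P Q : polygon R d N.+3) :
  regular_polygon P -> regular_polygon Q -> similar_polygons P Q.
Proof.
move=> regP regQ; have [eqlP _] := regular_unit_chord regP.
have [eqlQ _] := regular_unit_chord regQ.
case: regP => c [u [w [r [r0 u1 w1 uw hP]]]].
case: regQ => c' [u' [w' [r' [r'0 u'1 w'1 uw' hQ]]]].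
have unit2 (x : 'rV[R]_d) : enorm x = 1 -> edot x x = 1.
  by move=> h; rewrite -enorm_sqr h expr1n.
have [H [HD HZ He Hu Hw]] := isometry_orthonormal_pairs (unit2 _ u1)
  (unit2 _ w1) uw (unit2 _ u'1) (unit2 _ w'1) uw'.
have HB a b : H (a - b) = H a - H b by rewrite HD -scaleN1r HZ scaleN1r.
pose f x := c' + (r' / r) *: H (x - c).
have fB x y : f x - f y = (r' / r) *: H (x - y).
  rewrite /f opprD addrACA subrr add0r -scalerBr -HB.
  by rewrite opprB addrA subrK.
have fV i : f (vertex P i) = vertex Q i.
  rewrite /f hP hQ -[c + _ + _]addrA addrAC subrr add0r HD !HZ Hu Hw.
  rewrite scalerDr !scalerA addrA.
  by congr (_ + _ *: _ + _ *: _); field; rewrite gt_eqF.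
have fE i s : f (vertex P i + s *: (vertex P (i + 1) - vertex P i))
    = vertex Q i + s *: (vertex Q (i + 1) - vertex Q i).
  have -> (x y : 'rV[R]_d) : f (x + y) = f x + (f (x + y) - f x).
    by rewrite [RHS]addrC subrK.
  rewrite fB [X in X - vertex P i]addrC addrK HZ scalerA mulrC -scalerA -fB.
  by rewrite !fV.
exists f; split.
- exists (r' / r); split; first by rewrite divr_gt0.
  move=> x y; rewrite fB enormZ ?divr_ge0 ?ltW //.
  by rewrite /enorm He.
- apply/seteqP; split=> [_ [_ [t _ <-] <-]|_ [t _ <-]].
    have [i [s [hs ->]]] : exists i (s : R), 0 <= s <= 1 /\ Defs.pmap P t =
        vertex P i + s *: (vertex P (i + 1) - vertex P i).
      by apply/range_pmap => //; exists t.
    have [t' ht'] : exists t', Defs.pmap Q t' =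
        vertex Q i + s *: (vertex Q (i + 1) - vertex Q i).
      by apply/range_pmap => //; exists i, s.
    by exists t' => //; rewrite ht' -fE.
  have [i [s [hs ->]]] : exists i (s : R), 0 <= s <= 1 /\ Defs.pmap Q t =
      vertex Q i + s *: (vertex Q (i + 1) - vertex Q i).
    by apply/range_pmap => //; exists t.
  have [t' ht'] : exists t', Defs.pmap P t' =
      vertex P i + s *: (vertex P (i + 1) - vertex P i).
    by apply/range_pmap => //; exists i, s.
  exists (Defs.pmap P t'); first by exists t'.
  by rewrite ht' fE.
apply/seteqP; split=> [_ [_ [i _ <-] <-]|_ [i _ <-]].
  by exists i.
by exists (vertex P i) => //; exists i.
Qed.

Theorem theorem1p3 (R : realType) (d n : nat) (hd : (2 <= d)%N)
    (hn : (3 <= n)%N) (alpha q : R) (halpha : 0 < alpha) (hq : 1 <= q) :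
  (forall P : polygon R d n,
     equilateral_minimizer alpha q P -> regular_polygon P) /\
  (exists P : polygon R d n, regular_polygon P) /\
  (forall P : polygon R d n, regular_polygon P ->
     equilateral_minimizer alpha q P /\
     forall Q : polygon R d n,
       equilateral_minimizer alpha q Q -> similar_polygons P Q).
Proof.
case: n hn => [|[|[|N]]] // _.
have [P0 reg0] := regular_polygon_exists R N hd.
have minE P := minimizer_iff_regular P halpha hq reg0.
split; first by move=> P /minE.
split; first by exists P0.
move=> P regP; split=> [|Q /minE regQ]; first exact/minE.
exact: regular_polygons_similar.
Qed.
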